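(* Let $G$ be a graph whose cut polytope $P=CUT(G)$ is 2-level, and let $d$ be the dimension of $P$. Then $f_0(P)f_{d-1}(P)\leq d2^{d+1}$, and equality holds if and only if $P$ is affinely isomorphic to the $d$-dimensional cube or the $d$-dimensional cross-polytope.
   Context: For a $d$-dimensional polytope $P$, $f_0(P)$ is its number of vertices and $f_{d-1}(P)$ its number of facets. Convention for $d=0$: a point has no facets, so the product is $0$, and the $0$-dimensional cube and cross-polytope are points. The $d$-dimensional cube is $[-1,1]^d$ and the $d$-dimensional cross-polytope is its polar. A polytope $P$ is 2-level if for each facet $F$ of $P$ all vertices of $P$ not in $F$ lie in one common translate of the affine hull of $F$. For a finite graph $G$ with vertex set $V$ and edge set $E$, a cut is the set of edges with exactly one endpoint in $S$, for some $S\subseteq V$ (the empty set is a cut), and $CUT(G)\subseteq\mathbb{R}^E$ is the convex hull of the characteristic vectors of the cuts of $G$. *)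

(* Defs.v *)
From HB Require Import structures.
From mathcomp Require Import all_boot all_order all_algebra finmap.
From mathcomp Require Import boolp classical_sets functions cardinality reals.

Set Implicit Arguments.
Unset Strict Implicit.
Unset Printing Implicit Defensive.
Import Order.TTheory GRing.Theory Num.Theory.
Local Open Scope classical_set_scope.
Local Open Scope ring_scope.

Section Polytopes.
Variables (R : realType) (W : vectType R).
Implicit Types (A P F : set W).

Definition conv_hull A : set W :=
  [set x | exists (n : nat) (p : 'I_n -> W) (c : 'I_n -> R),
    [/\ forall i, A (p i), forall i, 0 <= c i, \sum_i c i = 1
      & x = \sum_i c i *: p i]].

Definition aff_hull A : set W :=
  [set x | exists (n : nat) (p : 'I_n -> W) (c : 'I_n -> R),
    [/\ forall i, A (p i), \sum_i c i = 1 & x = \sum_i c i *: p i]].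

Definition translate (t : W) A : set W := [set t + x | x in A].

(* For nonempty A, the affine hull is a translate of exactly one linear
   subspace U, and xget returns \dim U.  The value at the empty set is the
   junk value 0, so nonemptiness is required explicitly wherever it matters. *)
Definition aff_dim A : nat :=
  xget 0%N [set k | exists (U : {vspace W}) (t : W),
                      aff_hull A = translate t [set` U] /\ k = \dim U].

(* The improper faces P and set0 are included (take l = 0). *)
Definition face P F : Prop :=
  exists (l : {linear W -> R^o}) (b : R),
    (forall x, P x -> l x <= b) /\ F = P `&` [set x | l x = b].

Definition vertices P : set W := [set v | face P [set v]].

(* Written with a successor so that a 0-dimensional polytope has no facets. *)
Definition facets P : set (set W) :=
  [set F | [/\ face P F, F !=set0 & (aff_dim F).+1 = aff_dim P]].

(* The sets of vertices and facets of a polytope are finite; fset_set is the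
   library's conversion of a finite set to {fset _}. *)
Definition nb_vertices P : nat := #|` fset_set (vertices P)|.
Definition nb_facets P : nat := #|` fset_set (facets P)|.

Definition two_level P : Prop :=
  forall F, facets P F ->
    exists t : W, vertices P `\` F `<=` translate t (aff_hull F).

End Polytopes.

Definition affinely_isomorphic (R : realType) (W1 W2 : vectType R)
    (P : set W1) (Q : set W2) : Prop :=
  exists (g : {linear W1 -> W2}) (b : W2), set_bij P Q (fun x => g x + b).

Definition cube (R : realType) (d : nat) : set 'rV[R]_d :=
  [set x | forall i, -1 <= x 0 i <= 1].

Definition polar (R : realType) (d : nat) (A : set 'rV[R]_d) : set 'rV[R]_d :=
  [set y | forall x, A x -> \sum_i x 0 i * y 0 i <= 1].

Definition cross_polytope (R : realType) (d : nat) : set 'rV[R]_d :=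
  polar (@cube R d).

(* Edges carry an ordered pair of endpoints only for bookkeeping: the notions
   below do not depend on the order.  Loops and parallel edges are allowed;
   simple graphs are a special case. *)
Record graph := Graph {
  vertex_set : finType;
  edge_set : finType;
  ends : edge_set -> vertex_set * vertex_set
}.

Definition cut (G : graph) (S : {set vertex_set G}) : {set edge_set G} :=
  [set e | ((ends e).1 \in S) (+) ((ends e).2 \in S)].

Definition char_vec (R : realType) (E : finType) (C : {set E}) :
  {ffun E -> R^o} := [ffun e => (e \in C)%:R].

Definition CUT (R : realType) (G : graph) : set {ffun edge_set G -> R^o} :=
  conv_hull (range (fun S : {set vertex_set G} => char_vec R (cut S))).

(* Main.v *)
From HB Require Import structures.
Require Import Defs.
From mathcomp Require Import all_boot all_order all_algebra finmap ring lra.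
From mathcomp Require Import reals.

(** Write [V] for the vertices of the graph, and [D] for the set of pairs of
    distinct vertices joined by at least one edge.  A cut given by a vertex set
    [S] cuts the pair [p] exactly when the Walsh character
    [walsh p S = (-1) ^ #|p :&: S|] is [-1], so the cut polytope is, up to an
    affine change of coordinates and to repeated or constant ones, the convex
    hull of the sign vectors [(walsh p S)] with [p] in [D].  Distinct characters are orthogonal, hence
    the polytope has dimension [#|D|] ([aff_dim_CUT]), and its vertices are the
    distinct cut patterns ([nb_vertices_CUT]).  Let [K] be their number.

    If the polytope is 2-level, a facet is the zero set of a 0/1-valued function
    [a0 + \sum_(p in D) a p * walsh p S].  Such functions can be classified.
    Moving one vertex [v] to the other side changes the value by twice the sum
    of the terms with [v \in p], in which the signs are free, so that a pair
    with nonzero coefficient has either [`|a p| = 1/2], being the only one at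
    both of its ends, or [`|a p| = 1/4], with exactly one companion at each of
    its ends ([star_weights], [star_full], [star_half]).  In the first case the
    function is [1/2 +- walsh p / 2]; in the second one the three pairs met so
    far determine the rest of the function, and the support is a triangle or a
    quadrilateral ([single_edge_support], [cycle_support]).  For a triangle the
    constant term is [1/4] or [3/4], and [3/4] does not come from a facet,
    because the zero set is then contained in a strictly larger proper face
    ([facet_not_three_quarters]).  Counting signs, and writing [C] for the set
    of triangles and quadrilaterals, the number of facets is at most
    [2 #|D| + \sum_(Y in C) 2 ^ (#|Y| - 1)], which is at most
    [2 #|D| (1 + #|C|)]: a triangle contributes 4 and forces [3 <= #|D|], a
    quadrilateral contributes 8 and forces [4 <= #|D|].

    Finally every cut meets every cycle in an even number of pairs, so the cut
    patterns and the sets in [C], together with the empty set, are orthogonal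
    families of subsets of [D], and [K (1 + #|C|) <= 2 ^ #|D|] by Parseval
    ([walsh_packing]).  Multiplying the two bounds proves the inequality.

    Equality forces each member of [C] to have 4 elements and, unless [C] is
    empty, [#|D| = 4].  If [C] is empty, all [2 ^ #|D|] patterns are cuts and the
    polytope is a cube ([CUT_cube]).  Otherwise [D] is a single quadrilateral,
    the cuts are its 8 even subsets, and a Hadamard matrix of order 4 carries
    the polytope to the cross-polytope ([CUT_cross]).  Conversely, an affine
    isomorphism pulls vertices and facets of the cube or the cross-polytope
    back to the cut polytope, which gives the lower bound. *)

Set Implicit Arguments.
Unset Strict Implicit.
Unset Printing Implicit Defensive.
Import Order.TTheory GRing.Theory Num.Theory.
Local Open Scope ring_scope.

(** * Walsh characters of the subsets of a finite set *)

Section Walsh.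
Variables (R : realType) (T : finType).
Implicit Types (A B S : {set T}) (v : T).

Definition walsh A S : R := \prod_(i in A) (-1) ^+ (i \in S).

Definition toggle v S : {set T} := [set u | (u \in S) (+) (u == v)].

Lemma walsh0 S : walsh set0 S = 1.
Proof. by rewrite /walsh big_set0. Qed.

Lemma walshC A S : walsh A S = walsh S A.
Proof.
rewrite /walsh big_mkcond [RHS]big_mkcond; apply: eq_bigr => i _.
by do 2 case: (i \in _).
Qed.

Lemma walsh_sqr A S : walsh A S * walsh A S = 1.
Proof.
rewrite /walsh -big_split big1 //= => i _.
by rewrite -expr2 sqrr_sign.
Qed.

Lemma walsh_sign A S : walsh A S = (-1) ^+ (walsh A S < 0)%R.
Proof.
have /eqP : walsh A S ^+ 2 = 1 by rewrite expr2 walsh_sqr.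
by rewrite sqrf_eq1 => /orP[] /eqP ->; rewrite ?ltr10 ?ltrN10.
Qed.

Lemma walsh_card A S : walsh A S = (-1) ^+ #|A :&: S|.
Proof.
rewrite /walsh (bigID (mem S)) /= [X in _ * X]big1 ?mulr1.
  rewrite (eq_bigr (fun=> -1)) => [|i /andP[_ ->]] //.
  by rewrite prodr_const; congr (_ ^+ _); apply: eq_card => i; rewrite !inE.
by move=> i /andP[_ /negbTE ->].
Qed.

Lemma walshD A B S :
  walsh ((A :\: B) :|: (B :\: A)) S = walsh A S * walsh B S.
Proof.
rewrite /walsh big_mkcond [X in X * _]big_mkcond [X in _ * X]big_mkcond.
rewrite -big_split; apply: eq_bigr => i _ /=; rewrite !inE.
by case: (i \in A); case: (i \in B); rewrite //= ?mulr1 ?mul1r // -expr2 sqrr_sign.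
Qed.

Lemma walsh_toggle A v S : walsh A (toggle v S) = (-1) ^+ (v \in A) * walsh A S.
Proof.
rewrite /walsh; case: (boolP (v \in A)) => vA; last first.
  rewrite mul1r; apply: eq_bigr => i iA; rewrite inE.
  by case: eqP => [iv|]; rewrite ?addbF //; rewrite iv (negbTE vA) in iA.
rewrite (bigD1 v) //= [X in _ = _ * X](bigD1 v) //= inE eqxx addbT signrN.
rewrite mulrA mulN1r; congr (_ * _); apply: eq_bigr => i /andP[_ /negbTE iv].
by rewrite inE iv addbF.
Qed.

(** Expand a product over the points of [D]: each factor is [1 + 1] or [1 - 1],
    according to whether the point distinguishes [A] from [B]. *)
Lemma walsh_orthogonal_in (D A B : {set T}) : A \subset D -> B \subset D ->
  \sum_(S : {set T} | S \subset D) walsh A S * walsh B S =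
  (A == B)%:R * 2 ^+ #|D|.
Proof.
move=> AD BD.
pose F i : R := if i \in D then (-1) ^+ (i \in A) * (-1) ^+ (i \in B) else 0.
transitivity (\prod_i (F i + 1)); last first.
  case: eqP => [AB|/eqP AB].
    rewrite mul1r -prodr_const [RHS]big_mkcond; apply: eq_bigr => i _.
    by rewrite /F AB; case: ifP; rewrite ?add0r // -expr2 sqrr_sign.
  rewrite mul0r; have /exists_inP[i iD iAB] : [exists i in D, (i \in A) != (i \in B)].
    apply: contraNT AB; rewrite negb_exists_in => /forall_inP h; apply/eqP/setP => i.
    case: (boolP (i \in D)) => [/h|iD]; first by rewrite negbK => /eqP.
    by rewrite (contraNF (subsetP AD i)) // (contraNF (subsetP BD i)).
  rewrite (bigD1 i) //= /F iD; move: iAB.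
  by case: (i \in A); case: (i \in B) => //= _; rewrite ?mulr1 ?mul1r addNr mul0r.
rewrite bigA_distr [RHS](bigID (fun S : {set T} => S \subset D)) /=.
rewrite [X in _ = _ + X]big1 ?addr0; last first.
  move=> S /subsetPn[i iS iD]; rewrite (bigD1 i) //= iS /F (negbTE iD) mul0r //.
apply: eq_bigr => S /subsetP SD; rewrite ![walsh _ S]walshC /walsh -big_split big_mkcond.
by apply: eq_bigr => i _ /=; rewrite /F; case: ifP => // /SD ->.
Qed.

Lemma walsh_orthogonal A B :
  \sum_S walsh A S * walsh B S = (A == B)%:R * 2 ^+ #|T|.
Proof.
rewrite -cardsT -(walsh_orthogonal_in (subsetT A) (subsetT B)).
by apply: eq_bigl => S; rewrite subsetT.
Qed.

Lemma walsh_coeff (a : {set T} -> R) B :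
  \sum_S (\sum_A a A * walsh A S) * walsh B S = a B * 2 ^+ #|T|.
Proof.
under eq_bigr do rewrite mulr_suml.
rewrite exchange_big (bigD1 B) //= [X in _ + X]big1 => [|A AB].
  under eq_bigr do rewrite -mulrA.
  by rewrite -mulr_sumr walsh_orthogonal eqxx mul1r addr0.
under eq_bigr do rewrite -mulrA.
by rewrite -mulr_sumr walsh_orthogonal (negbTE AB) mul0r mulr0.
Qed.

(** Fourier uniqueness: coefficients are recovered by pairing with characters. *)
Lemma walsh_coeff_inj (a b : {set T} -> R) :
  (forall S, \sum_A a A * walsh A S = \sum_A b A * walsh A S) -> a =1 b.
Proof.
move=> ab B; apply: (@mulIf _ (2 ^+ #|T|)); first by rewrite expf_neq0 // pnatr_eq0.
by rewrite -!walsh_coeff; apply: eq_bigr => S _; rewrite ab.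
Qed.

End Walsh.
Arguments walsh R {T} A S.

Section Packing.
Variables (R : realType) (T : finType).

(** Parseval on the subsets of [D], applied to the sum [f] of the characters in
    [K]: the squares of [f] add up to [#|K| * 2 ^ #|D|], while [f] is equal to
    [#|K|] at each point of [Z]. *)
Lemma walsh_packing (D : {set T}) (K Z : {set {set T}}) :
  K \subset powerset D -> Z \subset powerset D ->
  (forall A Y, A \in K -> Y \in Z -> walsh R A Y = 1) ->
  (#|K| * #|Z| <= 2 ^ #|D|)%N.
Proof.
move=> KD ZD KZ.
have [->|K0] := eqVneq K set0; first by rewrite cards0.
have K_gt0 : (0 : R) < #|K|%:R by rewrite ltr0n card_gt0.
suff : #|K|%:R * (#|K|%:R * #|Z|%:R) <= #|K|%:R * (2 ^+ #|D|) :> R.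
  by rewrite ler_pM2l // -natrM -natrX ler_nat.
pose f Y : R := \sum_(A in K) walsh R A Y.
have -> : #|K|%:R * 2 ^+ #|D| = \sum_(Y : {set T} | Y \subset D) f Y ^+ 2.
  under [RHS]eq_bigr do rewrite expr2 mulr_suml.
  rewrite exchange_big /= -[#|K|]sum1_card natr_sum mulr_suml.
  apply: eq_bigr => A AK.
  under eq_bigr do rewrite mulr_sumr.
  rewrite exchange_big /= (bigD1 A) //= [X in _ + X]big1 => [|B /andP[BK BA]].
    rewrite walsh_orthogonal_in ?eqxx ?addr0 //.
      by have /subsetP/(_ _ AK) := KD; rewrite inE.
    by have /subsetP/(_ _ AK) := KD; rewrite inE.
  rewrite walsh_orthogonal_in.
  - by rewrite eq_sym (negbTE BA) mul0r.
  - by have /subsetP/(_ _ AK) := KD; rewrite inE.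
  - by have /subsetP/(_ _ BK) := KD; rewrite inE.
have -> : #|K|%:R * (#|K|%:R * #|Z|%:R) = \sum_(Y in Z) f Y ^+ 2.
  under eq_bigr => Y YZ.
    rewrite /f; under eq_bigr => A AK do rewrite KZ //.
    rewrite sumr_const.
  over.
  by rewrite sumr_const -[RHS]mulr_natr expr2 mulrA.
rewrite big_mkcond [leRHS]big_mkcond; apply: ler_sum => Y _.
case: ifP => [YZ|_]; last by case: ifP => // _; exact: sqr_ge0.
by have /subsetP/(_ _ YZ) := ZD; rewrite inE => ->.
Qed.

End Packing.

(** * Quadratic functions of signs with values 0 and 1 *)

Lemma pair_at (T : finType) (A : {set T}) v :
  #|A| = 2%N -> v \in A -> exists2 u, u != v & A = [set v; u].
Proof.
move=> /eqP/cards2P[x [y [xy ->]]]; rewrite !inE => /orP[] /eqP ->.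
  by exists y; rewrite // eq_sym.
by exists x; rewrite // setUC.
Qed.

Lemma walsh_pair (R : realType) (T : finType) (u v : T) S : u != v ->
  walsh R [set v; u] S = (-1) ^+ (v \in S) * (-1) ^+ (u \in S).
Proof.
by move=> uv; rewrite /walsh big_setU1 ?big_set1 // inE eq_sym.
Qed.

Section BooleanQuadratic.
Variables (R : realType) (V : finType) (a : {set V} -> R).
Hypothesis a_supp : forall A, a A != 0 -> A = set0 \/ #|A| = 2%N.
Hypothesis a_bool : forall S, \sum_A a A * walsh R A S = 0 \/
                              \sum_A a A * walsh R A S = 1.

Let a_card2 A v : a A != 0 -> v \in A -> #|A| = 2%N.
Proof. by move=> /a_supp[] // ->; rewrite inE. Qed.

Lemma toggle_difference v S :
  \sum_A a A * walsh R A S - \sum_A a A * walsh R A (toggle v S) =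
  2 * \sum_(A : {set V} | v \in A) a A * walsh R A S.
Proof.
rewrite -sumrB mulr_sumr [RHS]big_mkcond; apply: eq_bigr => A _.
rewrite walsh_toggle; case: ifP => _ /=.
  by rewrite expr1; ring.
by rewrite mul1r subrr.
Qed.

Lemma star_values v S (t := \sum_(A : {set V} | v \in A) a A * walsh R A S) :
  [\/ t = 0, t = 1/2 | t = - (1/2)].
Proof.
have := toggle_difference v S; rewrite -/t.
case: (a_bool S) => ->; case: (a_bool (toggle v S)) => -> h.
- by constructor 1; lra.
- by constructor 3; lra.
- by constructor 2; lra.
- by constructor 1; lra.
Qed.

(** The signs of the terms at [v] can be chosen independently, through the other
    ends of the pairs.  Aligning all of them shows that the sum of the absolute
    values is [0] or [1/2]; reversing only the sign of [A0] must again give a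
    value among [0], [1/2], [- (1/2)]. *)
Lemma star_weights v (A0 : {set V}) : v \in A0 -> a A0 != 0 ->
  \sum_(A : {set V} | v \in A) `|a A| = 1/2 /\
  (`|a A0| = 1/2 \/ `|a A0| = 1/4).
Proof.
move=> vA0 aA0; set M := \sum_(A | _) _.
(* Here [v] stays on the side where its own sign is [1]. *)
pose S0 := [set u | (a [set v; u] < 0) && (u != v)].
have S0_align (A : {set V}) : v \in A -> a A * walsh R A S0 = `|a A|.
  move=> vA; have [->|aA] := eqVneq (a A) 0; first by rewrite mul0r normr0.
  have [u uv ->] := pair_at (a_card2 aA vA) vA.
  rewrite walsh_pair // !inE eqxx andbF mul1r uv andbT mulrC.
  by rewrite normrEsign.
have S0_sum : \sum_(A : {set V} | v \in A) a A * walsh R A S0 = M.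
  exact: eq_bigr.
have [u uv A0E] := pair_at (a_card2 aA0 vA0) vA0.
have S1_sum : \sum_(A : {set V} | v \in A) a A * walsh R A (toggle u S0) =
    M - 2 * `|a A0|.
  rewrite /M (bigD1 A0) // [in RHS](bigD1 A0) //=.
  rewrite walsh_toggle {2}A0E !inE eqxx orbT mulN1r mulrN S0_align //.
  rewrite (eq_bigr (fun A => `|a A|)) => [|A /andP[vA AA0]]; first by ring.
  have [aA|aA] := eqVneq (a A) 0; first by rewrite aA mul0r normr0.
  have [w wv AE] := pair_at (a_card2 aA vA) vA.
  rewrite walsh_toggle (_ : (u \in A) = false) ?mul1r ?S0_align //.
  apply: contraNF AA0; rewrite AE A0E !inE (negbTE uv) /= => /eqP ->.
  by rewrite eqxx.
have a_gt0 : 0 < `|a A0| by rewrite normr_gt0.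
have M_ge : `|a A0| <= M by rewrite /M (bigD1 A0) //= lerDl sumr_ge0.
(* The aligned sum is positive, which leaves [1/2] only. *)
have := star_values v S0; rewrite S0_sum => -[] h.
- by exfalso; lra.
- split=> //; have := star_values v (toggle u S0); rewrite S1_sum => -[] h'.
  + by right; lra.
  + by exfalso; lra.
  + by left; lra.
- by exfalso; lra.
Qed.

Lemma star_full v (A0 : {set V}) : v \in A0 -> `|a A0| = 1/2 ->
  forall A : {set V}, v \in A -> A != A0 -> a A = 0.
Proof.
move=> vA0 aA0 A vA AA0.
have aA0' : a A0 != 0 by rewrite -normr_gt0 aA0; lra.
have [+ _] := star_weights vA0 aA0'; rewrite (bigD1 A0) //= (bigD1 A) ?vA //=.
rewrite aA0; set r := \sum_(_ | _) _ => h.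
have r_ge0 : 0 <= r by exact: sumr_ge0.
by apply/eqP; rewrite -normr_le0; lra.
Qed.

Lemma star_half v (A0 : {set V}) : v \in A0 -> `|a A0| = 1/4 ->
  exists A1 : {set V}, [/\ v \in A1, A1 != A0, `|a A1| = 1/4 &
    forall A : {set V}, v \in A -> A != A0 -> A != A1 -> a A = 0].
Proof.
move=> vA0 aA0.
have aA0' : a A0 != 0 by rewrite -normr_gt0 aA0; lra.
have [+ _] := star_weights vA0 aA0'; rewrite (bigD1 A0) //= aA0 => h.
have /existsP[A1 /and3P[vA1 A10 aA1]] :
    [exists A : {set V}, [&& v \in A, A != A0 & a A != 0]].
  apply: contraPT h => /existsPn h; rewrite big1 ?addr0; first by lra.
  move=> A /andP[vA AA0]; have := h A; rewrite vA AA0 negbK => /eqP ->.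
  by rewrite normr0.
exists A1; move: h; rewrite (bigD1 A1) ?vA1 //=; set r := \sum_(_ | _) _ => h.
have r_ge0 : 0 <= r by exact: sumr_ge0.
have [_ [] a1] := star_weights vA1 aA1; first by exfalso; lra.
have r0 : r = 0 by lra.
split=> // A vA AA0 AA1; apply/eqP; rewrite -normr_eq0.
by rewrite (psumr_eq0P _ r0) // vA AA0 AA1.
Qed.

Lemma sum_split3 (f : {set V} -> R) p0 p1 p2 : p1 != p0 -> p2 != p0 -> p2 != p1 ->
  \sum_A f A = f p0 + f p1 + f p2 + \sum_(A | A \notin [set p0; p1; p2]) f A.
Proof.
move=> p10 p20 p21.
rewrite (bigD1 p0) //= (bigD1 p1) //= (bigD1 p2) ?p20 //= !addrA.
by congr (_ + _); apply: eq_bigl => A; rewrite !inE !negb_or.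
Qed.

(** Reversing two signs at a time keeps the sign of [x * y * z].  If it is
    positive, the four sums take both values [r + 3/4] and [r - 1/4], and if it
    is negative, both [r - 3/4] and [r + 1/4].  Two numbers at distance 1 in
    [{0, 1}] are [0] and [1], and this determines [r]. *)
Lemma rigid_constant (r x y z : R) :
  `|x| = 1/4 -> `|y| = 1/4 -> `|z| = 1/4 ->
  r + x + y + z = 0 \/ r + x + y + z = 1 ->
  r - x - y + z = 0 \/ r - x - y + z = 1 ->
  r - x + y - z = 0 \/ r - x + y - z = 1 ->
  r + x - y - z = 0 \/ r + x - y - z = 1 ->
  r = 1/2 - 16 * (x * y * z).
Proof.
have quarter (w : R) : `|w| = 1/4 -> w = 1/4 \/ w = - (1/4).
  by case: (ger0P w) => _ h; [left|right]; lra.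
by move=> /quarter[] -> /quarter[] -> /quarter[] -> [] h1 [] h2 [] h3 [] h4; lra.
Qed.

Let Y := [set A | (A != set0) && (a A != 0)].

(** Moving an end of [p] reverses the term of [p] and fixes all the others, so
    the others add up to the constant [1/2]. *)
Lemma single_edge_support p : p != set0 -> `|a p| = 1/2 ->
  Y = [set p] /\ a set0 = 1/2.
Proof.
move=> p0 ap; have [v vp] := set0Pn _ p0.
pose rest S := \sum_(A | A != p) a A * walsh R A S.
have split S : \sum_A a A * walsh R A S = a p * walsh R p S + rest S.
  by rewrite (bigD1 p).
have rest_toggle S : rest (toggle v S) = rest S.
  apply: eq_bigr => A Ap; rewrite walsh_toggle; case: (boolP (v \in A)) => vA.
    by rewrite (star_full vp ap vA Ap) !mul0r.
  by rewrite mul1r.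
have rest_half S : rest S = 1/2.
  have := a_bool S; have := a_bool (toggle v S).
  rewrite !split rest_toggle walsh_toggle vp mulN1r.
  have : `|a p * walsh R p S| = 1/2.
    by rewrite normrM walsh_sign normr_sign mulr1.
  rewrite mulrN; set t := a p * _.
  by case: (ger0P t) => _ ht [] h [] h'; lra.
have coeff : (fun A => if A == p then 0 else a A) =1
             (fun A => if A == set0 then 1/2 else 0).
  apply: walsh_coeff_inj => S.
  rewrite [RHS](bigD1 set0) //= eqxx walsh0 mulr1 [X in _ = _ + X]big1.
    rewrite addr0 -(rest_half S) /rest [RHS]big_mkcond /=; apply: eq_bigr => A _.
    by case: eqP => // _; rewrite mul0r.
  by move=> A /negbTE ->; rewrite mul0r.
split; last by have := coeff set0; rewrite eqxx eq_sym (negbTE p0).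
apply/setP => A; rewrite !inE; have := coeff A.
have [->|Ap] := eqVneq A p; first by rewrite p0 -normr_gt0 ap; lra.
by case: eqP => //= _ ->; rewrite eqxx.
Qed.

(** Let [p1] and [p2] be the companions of [p0] at its two ends.  Moving the two
    ends of [p0] reverses two of the three terms and fixes the rest, so by
    [rigid_constant] the rest is an affine function of the product of the three
    characters, which is the character of [q], the symmetric difference of the
    three pairs.  By Fourier uniqueness nothing else is in the support.  The
    three pairs form a triangle if [q] is empty, and otherwise a path closed by
    [q] to a quadrilateral. *)
Lemma cycle_support p0 : p0 != set0 -> `|a p0| = 1/4 ->
  [/\ forall A, A \in Y -> `|a A| = 1/4,
      forall S, \prod_(A in Y) walsh R A S = 1 &
      (#|Y| = 3%N /\ a set0 = 1/2 - 16 * \prod_(A in Y) a A) \/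
      [/\ #|Y| = 4%N, a set0 = 1/2 & \prod_(A in Y) a A = - (1/256)]].
Proof.
move=> p0N0 ap0; have [u up0] := set0Pn _ p0N0.
have ap0N0 : a p0 != 0 by rewrite -normr_gt0 ap0; lra.
have [v vu p0E] := pair_at (a_card2 ap0N0 up0) up0.
have vp0 : v \in p0 by rewrite p0E !inE eqxx orbT.
have [p1 [up1 p10 ap1 star_u]] := star_half up0 ap0.
have [p2 [vp2 p20 ap2 star_v]] := star_half vp0 ap0.
have ap1N0 : a p1 != 0 by rewrite -normr_gt0 ap1; lra.
have ap2N0 : a p2 != 0 by rewrite -normr_gt0 ap2; lra.
have vp1 : v \notin p1.
  apply: contra p10 => vp1; have [w wu p1E] := pair_at (a_card2 ap1N0 up1) up1.
  move: vp1; rewrite p1E p0E !inE (negbTE vu) => /eqP ->; exact: eqxx.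
have p21 : p2 != p1 by apply: contraNneq vp1 => <-.
have up2 : u \notin p2.
  by apply: contraNN ap2N0 => up2; rewrite (star_u _ up2 p20 p21).
pose P := [set p0; p1; p2].
pose rest S := \sum_(A | A \notin P) a A * walsh R A S.
have split S : \sum_A a A * walsh R A S =
    rest S + a p0 * walsh R p0 S + a p1 * walsh R p1 S + a p2 * walsh R p2 S.
  by rewrite (sum_split3 _ p10 p20 p21) /rest; ring.
have rest_u S : rest (toggle u S) = rest S.
  apply: eq_bigr => A; rewrite !inE !negb_or -andbA => /and3P[A0 A1 A2].
  rewrite walsh_toggle; case: (boolP (u \in A)) => uA; last by rewrite mul1r.
  by rewrite (star_u _ uA A0 A1) !mul0r.
have rest_v S : rest (toggle v S) = rest S.
  apply: eq_bigr => A; rewrite !inE !negb_or -andbA => /and3P[A0 A1 A2].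
  rewrite walsh_toggle; case: (boolP (v \in A)) => vA; last by rewrite mul1r.
  by rewrite (star_v _ vA A0 A2) !mul0r.
pose q := let s := (p0 :\: p1) :|: (p1 :\: p0) in (s :\: p2) :|: (p2 :\: s).
have qE S : walsh R q S = walsh R p0 S * walsh R p1 S * walsh R p2 S.
  by rewrite !walshD.
pose c := a p0 * a p1 * a p2.
have restE S : rest S = 1/2 - 16 * c * walsh R q S.
  rewrite qE /c; set w0 := walsh R p0 S; set w1 := walsh R p1 S.
  set w2 := walsh R p2 S.
  rewrite (@rigid_constant (rest S) (a p0 * w0) (a p1 * w1) (a p2 * w2)).
  - by ring.
  - by rewrite normrM /w0 walsh_sign normr_sign mulr1.
  - by rewrite normrM /w1 walsh_sign normr_sign mulr1.
  - by rewrite normrM /w2 walsh_sign normr_sign mulr1.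
  - by rewrite -split.
  - have := a_bool (toggle u S); rewrite split rest_u !walsh_toggle up0 up1.
    by rewrite (negbTE up2) !mulN1r mul1r !mulrN.
  - have := a_bool (toggle v S); rewrite split rest_v !walsh_toggle vp0 vp2.
    by rewrite (negbTE vp1) !mulN1r mul1r !mulrN.
  - have := a_bool (toggle v (toggle u S)).
    rewrite split rest_v rest_u !walsh_toggle vp0 vp2 up0 up1.
    by rewrite (negbTE vp1) (negbTE up2) !mulN1r !mul1r !mulrN opprK.
have coeff : (fun A => if A \in P then 0 else a A) =1
   (fun A => (if A == set0 then 1/2 else 0) - (if A == q then 16 * c else 0)).
  apply: walsh_coeff_inj => S.
  transitivity (rest S).
    rewrite /rest [RHS]big_mkcond; apply: eq_bigr => A _; case: ifP => //= _.
    by rewrite mul0r.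
  under [RHS]eq_bigr do rewrite mulrBl.
  rewrite sumrB (bigD1 set0) //= eqxx walsh0 mulr1 [X in _ + X - _]big1; last first.
    by move=> A /negbTE ->; rewrite mul0r.
  rewrite (bigD1 q) //= eqxx [X in _ - (_ + X)]big1; last first.
    by move=> A /negbTE ->; rewrite mul0r.
  by rewrite !addr0 restE.
have cN : `|c| = 1/64 by rewrite /c !normrM ap0 ap1 ap2; field.
have PN0 : set0 \notin P.
  by rewrite !inE !negb_or -andbA; apply/and3P; split; rewrite eq_sym;
     apply/set0Pn; [exists u|exists u|exists v].
have qP : q \notin P.
  have uq : u \notin q by rewrite !inE up0 up1 (negbTE up2).
  have vq : v \notin q by rewrite !inE vp0 vp2 (negbTE vp1).
  rewrite !inE !negb_or -andbA; apply/and3P; split.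
  - by apply: contraNneq uq => ->.
  - by apply: contraNneq uq => ->.
  - by apply: contraNneq vq => ->.
have cardP : #|P| = 3%N.
  by rewrite /P setUC cardsU1 cards2 !inE negb_or p20 p21 eq_sym p10.
have prodP (f : {set V} -> R) : \prod_(A in P) f A = f p0 * f p1 * f p2.
  rewrite /P setUC big_setU1 /=; last by rewrite !inE negb_or p20.
  rewrite big_setU1 /=; last by rewrite inE eq_sym.
  by rewrite big_set1 mulrC.
have aP A : A \in P -> `|a A| = 1/4.
  by rewrite !inE -orbA => /or3P[] /eqP ->.
have a_set0 : a set0 = 1/2 - (if set0 == q then 16 * c else 0).
  by have := coeff set0; rewrite (negbTE PN0) eqxx.
have a_other A : A \notin P -> A != set0 -> A != q -> a A = 0.
  by move=> AP A0 Aq; have := coeff A;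
     rewrite (negbTE AP) (negbTE A0) (negbTE Aq) subr0.
have PY : P \subset Y.
  apply/subsetP => A AP; rewrite inE (contraNneq _ PN0) => [|<- //].
  by rewrite -normr_gt0 aP //; lra.
have [q0|q0] := eqVneq q set0.
  have YE : Y = P.
    apply/eqP; rewrite eqEsubset PY andbT; apply/subsetP => A.
    rewrite inE => /andP[A0]; apply: contraNT => AP.
    by rewrite (a_other _ AP A0) // q0.
  rewrite YE; split=> //; last left.
    by move=> S; rewrite prodP -qE q0 walsh0.
  by rewrite prodP cardP a_set0 q0 eqxx.
have aq : a q = - (16 * c).
  by have := coeff q; rewrite (negbTE qP) (negbTE q0) eqxx sub0r.
have YE : Y = q |: P.
  apply/eqP; rewrite eqEsubset subUset PY sub1set inE q0 andbT; apply/andP; split.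
    apply/subsetP => A; rewrite !in_setU1 inE => /andP[A0]; apply: contraNT.
    by rewrite negb_or => /andP[Aq AP]; rewrite (a_other _ AP A0 Aq).
  by rewrite -normr_gt0 aq normrN normrM cN; rewrite ger0_norm; lra.
rewrite YE; split.
- move=> A; rewrite in_setU1 => /orP[/eqP ->|/aP //].
  by rewrite aq normrN normrM cN ger0_norm; lra.
- by move=> S; rewrite big_setU1 //= prodP -qE walsh_sqr.
right; split.
- by rewrite cardsU1 qP cardP.
- by rewrite a_set0 eq_sym (negbTE q0) subr0.
rewrite big_setU1 //= prodP aq -/c.
have -> : - (16 * c) * c = - 16 * `|c| ^+ 2 by rewrite real_normK ?num_real //; ring.
by rewrite cN; field.
Qed.

End BooleanQuadratic.

From mathcomp Require Import boolp classical_sets functions cardinality.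

(** * Affine hulls and maximality of facets *)

Local Open Scope classical_set_scope.

Section Hulls.
Variables (R : realType) (W : vectType R).
Implicit Types (A P F : set W) (l : {linear W -> R^o}) (U : {vspace W}).

Lemma linear_comb l (I : finType) (c : I -> R) (p : I -> W) :
  l (\sum_i c i *: p i) = \sum_i c i * l (p i) :> R.
Proof. by rewrite linear_sum; apply: eq_bigr => i _; rewrite linearZ. Qed.

Lemma aff_hull_mono A P : A `<=` P -> aff_hull A `<=` aff_hull P.
Proof.
by move=> AP x [n [p [c [pA c1 xE]]]]; exists n, p, c; split=> // i; apply: AP.
Qed.

Lemma sub_aff_hull A : A `<=` aff_hull A.
Proof.
move=> x Ax; exists 1%N, (fun=> x), (fun=> 1).
by split; rewrite ?big_ord1 ?scale1r.
Qed.

Lemma sub_conv_hull A : A `<=` conv_hull A.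
Proof.
move=> x Ax; exists 1%N, (fun=> x), (fun=> 1).
by split; rewrite ?big_ord1 ?scale1r // => _; rewrite ler01.
Qed.

Lemma linear_aff_hull l b A :
  (forall x, A x -> l x = b) -> forall x, aff_hull A x -> l x = b.
Proof.
move=> lA x [n [p [c [pA c1 ->]]]]; rewrite linear_comb.
by under eq_bigr do rewrite lA //; rewrite -mulr_suml c1 mul1r.
Qed.

(** Take a maximal free family of directions: it exists because the ambient
    dimension bounds the size of free families. *)
Lemma aff_hull_translate A a0 : A a0 ->
  exists U, aff_hull A = translate a0 [set` U].
Proof.
move=> Aa0.
pose fr k := `[< exists s : seq W,
  [/\ size s = k, free s & {in s, forall w, A (a0 + w)}] >].
have fr0 : exists k, fr k.
  by exists 0%N; apply/asboolP; exists [::]; split; rewrite ?nil_free.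
have fr_le k : fr k -> (k <= dim W)%N.
  move=> /asboolP[s [<- fs _]]; rewrite -dimvf -(eqP fs); exact/dimvS/subvf.
case: (ex_maxnP fr0 fr_le) => k /asboolP[s [sk fs sA]] kmax.
have sU w : A (a0 + w) -> w \in <<s>>%VS.
  move=> Aw; apply: contraT => ws.
  suff /kmax : fr k.+1 by rewrite ltnn.
  apply/asboolP; exists (w :: s); split=> /=; first by rewrite sk.
    by rewrite free_cons ws.
  by move=> x; rewrite inE => /orP[/eqP ->|/sA].
exists <<s>>%VS; apply/seteqP; split=> x.
  move=> [n [p [c [pA c1 ->]]]].
  exists (\sum_i c i *: (p i - a0)) => /=.
    rewrite rpred_sum // => i _; rewrite rpredZ // sU //.
    by rewrite addrC subrK.
  rewrite -[X in X + _]scale1r -c1 scaler_suml -big_split /=.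
  by apply: eq_bigr => i _; rewrite -scalerDr addrC subrK.
move=> [u /= us <-]; pose t := in_tuple s.
exists (size s).+1, (fun i => if unlift ord0 i is Some j then a0 + t`_j else a0).
exists (fun i => if unlift ord0 i is Some j then coord t j u
                 else 1 - \sum_j coord t j u).
split.
- by move=> i; case: unliftP => // j _; apply/sA/mem_nth/ltn_ord.
- rewrite big_ord_recl unlift_none [X in _ + X](eq_bigr (fun j => coord t j u)).
    by rewrite subrK.
  by move=> j _; rewrite liftK.
rewrite big_ord_recl unlift_none.
rewrite [X in _ = _ + X](eq_bigr (fun j => coord t j u *: a0 + coord t j u *: t`_j)).
  rewrite big_split /= -(@coord_span _ _ _ t) // addrA; congr (_ + _).
  by rewrite -scaler_suml -scalerDl subrK scale1r.
by move=> j _; rewrite liftK scalerDr.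
Qed.

Lemma translate_inj t1 t2 U1 U2 :
  translate t1 [set` U1] = translate t2 [set` U2] -> U1 = U2.
Proof.
have half s1 s2 (X1 X2 : {vspace W}) :
    translate s1 [set` X1] = translate s2 [set` X2] -> (X1 <= X2)%VS.
  move=> e; apply/subvP => u uX.
  have /= [v vX sv] : translate s2 [set` X2] (s1 + u) by rewrite -e; exists u.
  have /= [w wX sw] : translate s2 [set` X2] s1.
    by rewrite -e; exists 0; rewrite /= ?mem0v ?addr0.
  have vE : v = w + u by apply: (addrI s2); rewrite sv addrA sw.
  have -> : u = v - w by rewrite vE addrC addKr.
  exact: rpredB.
by move=> e; apply/eqP; rewrite eqEsubv (half _ _ _ _ e) (half _ _ _ _ (esym e)).
Qed.

Lemma aff_dimE A t U : aff_hull A = translate t [set` U] -> aff_dim A = \dim U.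
Proof.
move=> AE; apply: xget_unique; first by exists U, t.
by move=> k [U' [t' [AE' ->]]]; rewrite (@translate_inj t t' U U') // -AE.
Qed.

Lemma faceS P F : face P F -> F `<=` P.
Proof. by move=> [l [b [_ ->]]] x []. Qed.

(** A point of [F'] outside [F] would, together with [F], affinely span the
    whole of [P], and then the functional defining [F'] would be constant on
    [P]. *)
Lemma facet_maximal P F F' : facets P F -> face P F' -> F `<=` F' -> F' <> P ->
  F' = F.
Proof.
move=> [[l [b [lP FE]]] [f0 Ff0] dimF] [l' [b' [lP' FE']]] FF' F'P.
have FP : F `<=` P by rewrite FE => x [].
have [UF UFE] := aff_hull_translate Ff0.
have [U UE] := aff_hull_translate (FP _ Ff0).
rewrite (aff_dimE UFE) (aff_dimE UE) in dimF.
have lF x : F x -> l x = b by rewrite FE => -[].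
have lF' x : F x -> l' x = b' by move=> /FF'; rewrite FE' => -[].
have ker l1 b1 : (forall x, F x -> l1 x = b1) -> forall u, u \in UF -> l1 u = 0.
  move=> l1F u uUF; have : l1 (f0 + u) = b1.
    by apply: (linear_aff_hull l1F); rewrite UFE; exists u.
  by rewrite linearD (l1F _ Ff0) => /(canRL (addKr _)); rewrite addNr.
have UFU : (UF <= U)%VS.
  apply/subvP => u uUF.
  have : aff_hull P (f0 + u) by apply: (aff_hull_mono FP); rewrite UFE; exists u.
  by rewrite UE => -[w wU /addrI <-].
apply/seteqP; split=> //; move=> y F'y; apply: contrapT => Fy; apply: F'P.
have Py : P y by move: F'y; rewrite FE' => -[].
have dirU x : P x -> x - f0 \in U.
  by move=> /sub_aff_hull; rewrite UE => -[w wU <-]; rewrite addrC addKr.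
have zUF : y - f0 \notin UF.
  apply/negP => /(ker _ _ lF); rewrite linearB (lF _ Ff0) => /eqP.
  by rewrite subr_eq0 => /eqP ly; apply: Fy; rewrite FE.
have UE' : U = (UF + <[y - f0]>)%VS.
  apply/esym/eqP; rewrite eqEdim subv_add UFU -memvE dirU //= -dimF.
  have dirct : (UF :&: <[y - f0]> = 0)%VS.
    apply/eqP; rewrite -subv0; apply/subvP => w; rewrite memv_cap memv0.
    move=> /andP[wUF /vlineP[k wE]]; rewrite wE; have [->|k0] := eqVneq k 0.
      by rewrite scale0r.
    case/negP: zUF; rewrite (_ : y - f0 = k^-1 *: w) ?rpredZ //.
    by rewrite wE scalerA mulVf // scale1r.
  rewrite dimv_disjoint_sum // dim_vline.
  have -> : (y - f0 != 0) by apply: contraNneq zUF => ->; exact: mem0v.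
  by rewrite addn1.
apply/seteqP; split=> x; first by rewrite FE' => -[].
move=> Px; rewrite FE'; split=> //=; have := dirU _ Px; rewrite UE'.
move=> /memv_addP[u uUF [w /vlineP[k ->] xE]].
have : l' (x - f0) = 0.
  rewrite xE linearD (ker _ _ lF') // add0r linearZ linearB (lF' _ Ff0) /=.
  by move: F'y; rewrite FE' => -[_ ->]; rewrite subrr scaler0.
by rewrite linearB (lF' _ Ff0) => /eqP; rewrite subr_eq0 => /eqP.
Qed.

End Hulls.

(** * Convex hulls of finite families *)

Lemma sum_enum_val (M : nmodType) (I : finType) (F : I -> M) :
  \sum_i F i = \sum_(k < #|I|) F (enum_val k).
Proof. by rewrite -big_enum_val; apply: eq_bigl. Qed.

Section FiniteHull.
Variables (R : realType) (W : vectType R) (I : finType) (p : I -> W).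
Implicit Types (F : set W) (c : I -> R).
Local Notation P := (conv_hull (range p)).

Lemma conv_hull_family x : P x ->
  exists c, [/\ forall i, 0 <= c i, \sum_i c i = 1 & x = \sum_i c i *: p i].
Proof.
move=> [n [q [c [qP c0 c1 ->]]]].
have /choice[j jE] : forall k, exists i, p i = q k.
  by move=> k; have [i _ <-] := qP k; exists i.
exists (fun i => \sum_(k | j k == i) c k); split.
- by move=> i; exact: sumr_ge0.
- by rewrite -c1 [RHS](partition_big j xpredT).
rewrite (partition_big j xpredT) //=; apply: eq_bigr => i _.
by rewrite scaler_suml; apply: eq_bigr => k /eqP <-; rewrite jE.
Qed.

Lemma family_conv_hull c : (forall i, 0 <= c i) -> \sum_i c i = 1 ->
  P (\sum_i c i *: p i).
Proof.
move=> c0 c1; exists #|I|, (p \o enum_val), (c \o enum_val); split=> //=.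
- by move=> k; exists (enum_val k).
- by rewrite -c1 [RHS]sum_enum_val.
- exact: sum_enum_val.
Qed.

Lemma family_aff_hull c : \sum_i c i = 1 ->
  aff_hull P (\sum_i c i *: p i).
Proof.
move=> c1; exists #|I|, (p \o enum_val), (c \o enum_val); split=> //=.
- by move=> k; apply: sub_conv_hull; exists (enum_val k).
- by rewrite -c1 [RHS]sum_enum_val.
- exact: sum_enum_val.
Qed.

Lemma conv_hull_idem : conv_hull P `<=` P.
Proof.
move=> x [n [q [c [qP c0 c1 ->]]]].
have /choice[C CE] : forall k, exists c, [/\ forall i, 0 <= c i, \sum_i c i = 1 &
    q k = \sum_i c i *: p i] by move=> k; exact: conv_hull_family (qP k).
under eq_bigr => k _ do rewrite (let: And3 _ _ e := CE k in e) scaler_sumr.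
rewrite exchange_big /=.
under eq_bigr => i _ do under eq_bigr => k _ do rewrite scalerA.
under eq_bigr => i _ do rewrite -scaler_suml.
apply: family_conv_hull => [i|].
  by apply: sumr_ge0 => k _; apply: mulr_ge0 => //; case: (CE k).
rewrite exchange_big /= -c1; apply: eq_bigr => k _; rewrite -mulr_sumr.
by case: (CE k) => _ -> _; rewrite mulr1.
Qed.

Lemma linear_conv_hull_le (l : {linear W -> R^o}) b :
  (forall i, l (p i) <= b) -> forall x, P x -> l x <= b.
Proof.
move=> lp x /conv_hull_family[c [c0 c1 ->]]; rewrite linear_comb.
rewrite -[b]mul1r -c1 mulr_suml; apply: ler_sum => i _.
exact: ler_wpM2l.
Qed.

(** A convex combination that maximizes a functional only involves maximizers. *)
Lemma face_family F y : face P F -> F y ->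
  exists c, [/\ forall i, 0 <= c i, \sum_i c i = 1, y = \sum_i c i *: p i &
    forall i, c i != 0 -> F (p i)].
Proof.
move=> [l [b [lP FE]]] Fy; have : P y by move: Fy; rewrite FE => -[].
move=> /conv_hull_family[c [c0 c1 yE]]; exists c; split=> // i ci.
have Pp j : P (p j) by apply: sub_conv_hull; exists j.
rewrite FE; split=> //=.
have gap_ge0 j : true -> 0 <= c j * (b - l (p j)).
  by move=> _; rewrite mulr_ge0 // subr_ge0 lP.
have gap0 : \sum_j c j * (b - l (p j)) = 0.
  under eq_bigr do rewrite mulrBr.
  rewrite sumrB -mulr_suml c1 mul1r -linear_comb -yE.
  by move: Fy; rewrite FE => -[_ /= ->]; rewrite subrr.
have /eqP := psumr_eq0P gap_ge0 gap0 (isT : true) (i := i).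
by rewrite mulf_eq0 (negbTE ci) subr_eq0 => /eqP ->.
Qed.

Lemma face_eq F F' : face P F -> face P F' ->
  (forall i, F (p i) -> F' (p i)) -> F `<=` F'.
Proof.
move=> fF [l [b [lP FE']]] FF' y Fy; have Py := faceS fF Fy.
have [c [c0 c1 yE cF]] := face_family fF Fy.
rewrite FE'; split=> //=; rewrite yE linear_comb -[b]mul1r -c1 mulr_suml.
apply: eq_bigr => i _; have [->|/cF/FF'] := eqVneq (c i) 0; first by rewrite !mul0r.
by rewrite FE' => -[_ ->].
Qed.

Lemma vertex_family v : vertices P v -> exists i, v = p i.
Proof.
move=> fv; have [c [c0 c1 vE cv]] := face_family fv (erefl v : [set v] v).
suff /existsP[i ci] : [exists i, c i != 0] by exists i; rewrite (cv _ ci).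
apply/existsP/not_existsP => h.
have : \sum_i c i = 0 :> R.
  by apply: big1 => i _; apply/eqP/negPn/negP => ci; exact: (h i).
by rewrite c1 => /eqP; rewrite oner_eq0.
Qed.

End FiniteHull.

Section Counting.
Variables (T : finType) (U : choiceType) (A : set U) (C : {set T}) (f : T -> U).

Lemma fset_set_card_le : A `<=` [set f t | t in [set` C]] ->
  finite_set A /\ (#|` fset_set A| <= #|C|)%N.
Proof.
move=> AC.
have finA : finite_set A.
  by apply: sub_finite_set AC _; apply: finite_image; exact: finite_finset.
split=> //; rewrite cardE -(size_map f); apply: uniq_leq_size => //.
move=> x; rewrite in_fset_set // inE => /AC[t tC <-].
by apply: map_f; rewrite mem_enum.
Qed.

Lemma card_le_fset_set : finite_set A -> {in C &, injective f} ->
  (forall t, t \in C -> A (f t)) -> (#|C| <= #|` fset_set A|)%N.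
Proof.
move=> finA f_inj fA; rewrite cardE -(size_map f); apply: uniq_leq_size.
  by rewrite map_inj_in_uniq ?enum_uniq // => x y; rewrite !mem_enum; exact: f_inj.
move=> x /mapP[t]; rewrite mem_enum => tC ->.
by rewrite in_fset_set // inE; exact: fA.
Qed.

End Counting.

(** * Pulling faces back along an affine isomorphism *)

Lemma affine_comb (R : realType) (W1 W2 : vectType R) (g : {linear W1 -> W2})
    (b0 : W2) (I : finType) (c : I -> R) (x : I -> W1) : \sum_i c i = 1 ->
  g (\sum_i c i *: x i) + b0 = \sum_i c i *: (g (x i) + b0).
Proof.
move=> c1; under [RHS]eq_bigr do rewrite scalerDr.
rewrite big_split /= -scaler_suml c1 scale1r linear_sum; congr (_ + _).
by apply: eq_bigr => i _; rewrite linearZ.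
Qed.

Section Transport.
Variables (R : realType) (W1 W2 : vectType R) (I : finType) (p : I -> W1).
Variables (Q : set W2) (g : {linear W1 -> W2}) (b0 : W2).
Local Notation P := (conv_hull (range p)).
Local Notation h := (fun x => g x + b0).
Hypothesis hPQ : set_bij P Q h.

Definition pullback (G : set W2) : set W1 := P `&` [set x | G (h x)].

Let hQ x : P x -> Q (h x). Proof. by case: hPQ => hQ _ _; exact: hQ. Qed.

Let h_inj x y : P x -> P y -> g x = g y -> x = y.
Proof.
by case: hPQ => _ hI _ Px Py gxy; apply: hI; rewrite ?inE //= gxy.
Qed.

Let h_onto y : Q y -> exists2 x, P x & h x = y.
Proof. by case: hPQ => _ _ hS /hS[x Px <-]; exists x. Qed.

Lemma conv_hull_cons n (a0 : W1) (q : 'I_n -> W1) (c0 : R) (c : 'I_n -> R) :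
  P a0 -> (forall i, P (q i)) -> 0 <= c0 -> (forall i, 0 <= c i) ->
  c0 + \sum_i c i = 1 -> P (c0 *: a0 + \sum_i c i *: q i).
Proof.
move=> Pa0 Pq c0_ge0 c_ge0 c1; apply: conv_hull_idem.
exists n.+1, (fun i => if unlift ord0 i is Some j then q j else a0).
exists (fun i => if unlift ord0 i is Some j then c j else c0); split.
- by move=> i; case: unliftP.
- by move=> i; case: unliftP.
- rewrite -[RHS]c1 big_ord_recl unlift_none; congr (_ + _).
  by apply: eq_bigr => i _; rewrite liftK.
- rewrite big_ord_recl unlift_none; congr (_ + _).
  by apply: eq_bigr => i _; rewrite liftK.
Qed.

(** A map that is injective on a convex set is injective on its affine hull:
    a sufficiently small multiple of a direction in the affine hull can be added
    to the barycenter [z0] of finitely many points without leaving the set. *)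
Lemma aff_hull_injective x a0 : aff_hull P x -> P a0 -> g x = g a0 -> x = a0.
Proof.
move=> [n [q [c [Pq c1 xE]]]] Pa0 gx.
pose N : R := n.+1%:R; pose s := 1 + \sum_i `|c i|.
have N_gt0 : 0 < N by rewrite ltr0n.
have s_ge1 : 1 <= s by rewrite lerDl sumr_ge0.
have s_gt0 : 0 < s by lra.
(* Small enough for all the weights of [z1] to be nonnegative. *)
pose e := N^-1 / s.
have e_gt0 : 0 < e by rewrite divr_gt0 // invr_gt0.
have c_le i : e * `|c i| <= N^-1.
  rewrite /e mulrAC ler_pdivrMr // ler_pM2l ?invr_gt0 //.
  by rewrite /s (bigD1 i) //= addrCA lerDl addr_ge0 // sumr_ge0.
have e_le : e <= N^-1.
  by rewrite /e ler_pdivrMr // ler_peMr // invr_ge0 ltW.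
have sumN : N^-1 + \sum_(i < n) N^-1 = 1.
  rewrite sumr_const card_ord -mulrS -mulr_natr mulVf //; exact: lt0r_neq0.
have z0 : P (N^-1 *: a0 + \sum_i N^-1 *: q i).
  by apply: conv_hull_cons => // *; rewrite invr_ge0 ltW.
have z1 : P ((N^-1 - e) *: a0 + \sum_i (N^-1 + e * c i) *: q i).
  apply: conv_hull_cons => //.
  - by rewrite subr_ge0.
  - move=> i; rewrite -[e * c i]opprK subr_ge0; apply: le_trans (c_le i).
    by apply: le_trans (ler_norm _) _; rewrite normrN normrM (gtr0_norm e_gt0).
  - by rewrite big_split /= -mulr_sumr c1 mulr1 addrACA sumN addNr addr0.
have zE : (N^-1 - e) *: a0 + \sum_i (N^-1 + e * c i) *: q i =
    N^-1 *: a0 + \sum_i N^-1 *: q i + e *: (x - a0).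
  have xe : e *: x = \sum_i e *: (c i *: q i) by rewrite xE scaler_sumr.
  under eq_bigr do rewrite scalerDl -scalerA.
  rewrite big_split /= -xe scalerBl scalerBr.
  by rewrite addrACA (addrC (- _)).
have /(h_inj z1 z0) : g ((N^-1 - e) *: a0 + \sum_i (N^-1 + e * c i) *: q i) =
    g (N^-1 *: a0 + \sum_i N^-1 *: q i).
  by rewrite zE [LHS]linearD linearZ linearB /= gx subrr scaler0 addr0.
rewrite zE => /eqP; rewrite -subr_eq0 addrAC subrr add0r scaler_eq0.
by rewrite (gt_eqF e_gt0) /= subr_eq0 => /eqP.
Qed.

Lemma aff_dim_pullback G : G `<=` Q -> G !=set0 -> aff_dim (pullback G) = aff_dim G.
Proof.
move=> GQ [y0 Gy0]; have [a0 Pa0 a0E] := h_onto (GQ _ Gy0).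
have Fa0 : pullback G a0 by split=> //=; rewrite a0E.
have [U UE] := aff_hull_translate Fa0.
have GE : aff_hull G = translate (h a0) [set` (linfun g @: U)%VS].
  apply/seteqP; split=> y.
    move=> [n [q [c [Gq c1 ->]]]].
    have /choice[x xE] : forall i, exists x, P x /\ h x = q i.
      by move=> i; have [x Px xq] := h_onto (GQ _ (Gq i)); exists x.
    have : aff_hull (pullback G) (\sum_i c i *: x i).
      exists n, x, c; split=> // i; have [Px xq] := xE i.
      by split=> //=; rewrite xq.
    rewrite UE => -[u /= uU ux]; exists (g u).
      by rewrite /= -[g u]lfunE memv_img.
    rewrite addrAC -linearD ux affine_comb //.
    by apply: eq_bigr => i _; have [_ ->] := xE i.
  move=> [_ /= /memv_imgP[u uU ->] <-]; rewrite lfunE /= addrAC -linearD.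
  have [n [x [c [Fx c1 ->]]]] : aff_hull (pullback G) (a0 + u).
    by rewrite UE; exists u.
  exists n, (h \o x), c; split=> //; last exact: affine_comb.
  by move=> i; case: (Fx i).
rewrite (aff_dimE UE) (aff_dimE GE) limg_dim_eq //.
apply/eqP; rewrite -subv0; apply/subvP => u; rewrite memv_cap memv0 memv_ker.
rewrite lfunE => /andP[uU /eqP gu].
have -> : u = (a0 + u) - a0 by rewrite addrC addKr.
rewrite subr_eq0; apply/eqP/aff_hull_injective => //.
  by apply: (@aff_hull_mono _ _ (pullback G)) => [z []//|]; rewrite UE; exists u.
by rewrite linearD gu addr0.
Qed.

Lemma face_pullback G : face Q G -> face P (pullback G).
Proof.
move=> [l [b [lQ GE]]].
exists (l \o g : {linear W1 -> R^o}), (b - l b0); split.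
  by move=> x /hQ/lQ; rewrite linearD /= lerBrDr.
rewrite /pullback GE; apply/seteqP; split=> x [Px] /=.
  by move=> [_ <-]; split=> //=; rewrite linearD addrK.
by move=> lx; split=> //; split; [exact: hQ|rewrite /= linearD lx subrK].
Qed.

Lemma pullback_inj G1 G2 : G1 `<=` Q -> G2 `<=` Q ->
  pullback G1 = pullback G2 -> G1 = G2.
Proof.
have half A B : A `<=` Q -> pullback A = pullback B -> A `<=` B.
  move=> AQ AB y Ay; have [x Px xy] := h_onto (AQ _ Ay).
  have : pullback A x by split=> //=; rewrite xy.
  by rewrite AB => -[_ /=]; rewrite xy.
by move=> Q1 Q2 e; apply/seteqP; split; apply: half.
Qed.

Lemma facet_pullback G : facets Q G -> facets P (pullback G).
Proof.
move=> [fG G0 dimG]; have GQ := faceS fG.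
have Q0 : Q !=set0 by have [y /GQ] := G0; exists y.
have QE : pullback Q = P by apply/seteqP; split=> x; [case|move=> Px; split=> //=; exact: hQ].
split; first exact: face_pullback.
  have [y Gy] := G0; have [x Px xy] := h_onto (GQ _ Gy).
  by exists x; split=> //=; rewrite xy.
by rewrite aff_dim_pullback // dimG -QE aff_dim_pullback.
Qed.

Lemma vertex_pullback v : vertices Q v -> exists2 x, vertices P x & h x = v.
Proof.
move=> fv; have Qv : Q v := faceS fv (erefl v).
have [x Px xv] := h_onto Qv; exists x => //.
rewrite /vertices /= (_ : [set x] = pullback [set v]); first exact: face_pullback fv.
apply/seteqP; split=> y /=; first by move=> ->; split.
by move=> [Py /= yv]; apply: h_inj => //; apply: (addIr b0); rewrite yv xv.
Qed.

Lemma nb_facets_pullback (T : finType) (G : T -> set W2) :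
  finite_set (facets P) -> injective G -> (forall t, facets Q (G t)) ->
  (#|T| <= nb_facets P)%N.
Proof.
move=> fin G_inj Gf; rewrite -cardsT.
apply: (@card_le_fset_set _ _ _ [set: T]%SET (pullback \o G)) => //.
  by move=> s t _ _ /= e; apply: G_inj; apply: pullback_inj e; [have [/faceS//] := Gf s|have [/faceS//] := Gf t].
by move=> t _; exact: facet_pullback.
Qed.

Lemma nb_vertices_pullback (T : finType) (v : T -> W2) :
  finite_set (vertices P) -> injective v -> (forall t, vertices Q (v t)) ->
  (#|T| <= nb_vertices P)%N.
Proof.
move=> fin v_inj vQ; rewrite -cardsT.
have /choice[x xE] : forall t, exists x, vertices P x /\ h x = v t.
  by move=> t; have [x Px xv] := vertex_pullback (vQ t); exists x.
apply: (@card_le_fset_set _ _ _ [set: T]%SET x) => //.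
  move=> s t _ _ xst; apply: v_inj.
  by have [_ <-] := xE s; have [_ <-] := xE t; rewrite xst.
by move=> t _; have [] := xE t.
Qed.

End Transport.

Lemma conv_hull_mono (R : realType) (W : vectType R) (A B : set W) :
  A `<=` B -> conv_hull A `<=` conv_hull B.
Proof.
by move=> AB x [n [p [c [pA c0 c1 xE]]]]; exists n, p, c; split=> // i; exact: AB.
Qed.

Lemma isomorphic_conv_hull (R : realType) (W1 W2 : vectType R) (I : finType)
    (p : I -> W1) (Q : set W2) (g : {linear W1 -> W2}) (b0 : W2) :
  (forall x y, conv_hull (range p) x -> conv_hull (range p) y -> g x = g y -> x = y) ->
  conv_hull Q `<=` Q -> (forall i, Q (g (p i) + b0)) ->
  Q `<=` conv_hull (range (fun i => g (p i) + b0)) ->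
  affinely_isomorphic (conv_hull (range p)) Q.
Proof.
move=> g_inj Qconv Qp Qhull.
exists g, b0; split.
- move=> x /conv_hull_family[c [c0 c1 ->]]; rewrite affine_comb //; apply: Qconv.
  apply: (conv_hull_mono _ (family_conv_hull _ c0 c1)) => _ [i _ <-].
  exact: Qp.
- by move=> x y; rewrite !inE => Px Py /addIr; exact: g_inj.
- move=> y /Qhull/conv_hull_family[c [c0 c1 ->]]; exists (\sum_i c i *: p i).
    exact: family_conv_hull.
  exact: affine_comb.
Qed.

(** * The cube and the cross-polytope *)

Section Hyperplanes.
Variables (R : realType) (W : vectType R).

(** A point of the line through [c0] and another point of [A] is in the affine
    hull, so it suffices to reach [A] when shrinking towards [c0]. *)
Lemma shrinking_aff_hull (A H : set W) c0 : A c0 ->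
  (forall x, H x -> exists2 e : R, 0 < e & A (c0 + e *: (x - c0))) ->
  H `<=` aff_hull A.
Proof.
move=> Ac0 HA x /HA[e e0 Ae].
exists 2%N, (fun i => if i == ord0 then c0 else c0 + e *: (x - c0)).
exists (fun i => if i == ord0 then 1 - e^-1 else e^-1); split.
- by move=> i; case: ifP.
- by rewrite !big_ord_recl big_ord0 /= addr0 subrK.
rewrite !big_ord_recl big_ord0 /= addr0 scalerBl scale1r scalerDr scalerA.
by rewrite mulVf ?lt0r_neq0 // scale1r addrA subrK addrC subrK.
Qed.

(** The two shrinking conditions say that [o] is algebraically interior to
    [Q], and [c0] to the face in its hyperplane; the dimensions are then those of the ambient space
    and of the kernel of a nonzero functional. *)
Lemma hyperplane_facet (Q : set W) (o c0 w0 : W) (l : {linear W -> R^o}) (b : R) :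
  Q o -> (forall x, exists2 e : R, 0 < e & Q (o + e *: (x - o))) ->
  (forall x, Q x -> l x <= b) -> Q c0 -> l c0 = b -> l w0 != 0 ->
  (forall x, l x = b -> exists2 e : R, 0 < e & Q (c0 + e *: (x - c0))) ->
  facets Q (Q `&` [set x | l x = b]).
Proof.
move=> Qo Qstar lQ Qc0 lc0 lw0 Fstar; split; first by exists l, b.
  by exists c0.
have QE : aff_hull Q = translate 0 [set` {:W}%VS].
  apply/seteqP; split=> x _; first by exists x; rewrite /= ?memvf ?add0r.
  apply: (@shrinking_aff_hull Q setT o) => //.
have FE : aff_hull (Q `&` [set x | l x = b]) = translate c0 [set` lker (linfun l)].
  apply/seteqP; split=> x.
    move=> /(@linear_aff_hull _ _ l b) lx; exists (x - c0) => /=.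
      by rewrite memv_ker lfunE /= linearB lc0 lx ?subrr // => y [].
    by rewrite addrC subrK.
  move=> [u /=]; rewrite memv_ker lfunE /= => /eqP lu <-.
  apply: (@shrinking_aff_hull _ [set x | l x = b] c0) => //=; last first.
    by rewrite linearD lu addr0.
  move=> y ly; have [e e0 Qe] := Fstar _ ly; exists e => //; split=> //=.
  by rewrite linearD linearZ linearB /= ly lc0 subrr scaler0 addr0.
rewrite (aff_dimE QE) (aff_dimE FE) -(limg_ker_dim (linfun l) fullv).
rewrite capfv -addn1; congr (_ + _)%N; apply/eqP; rewrite eqn_leq.
have -> : (0 < \dim (linfun l @: fullv))%N.
  rewrite lt0n dimv_eq0; apply: contraNneq lw0 => im0.
  by rewrite -memv0 -im0 -[l w0]lfunE memv_img ?memvf.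
by rewrite andTb (leq_trans (dimvS (subvf _))) // dimvf.
Qed.

End Hyperplanes.

Section RowFunctionals.
Variables (R : realType) (d : nat).

Definition dotr (a : 'I_d -> R) (y : 'rV[R]_d) : R^o := \sum_i a i * y 0 i.

Fact dotr_linear a : linear (dotr a).
Proof.
move=> k x y; rewrite /dotr scaler_sumr -big_split /=; apply: eq_bigr => i _.
by rewrite !mxE mulrDr mulrCA.
Qed.

HB.instance Definition _ a :=
  GRing.isLinear.Build R 'rV[R]_d R^o _ (dotr a) (dotr_linear a).

Lemma dotr_delta a i k : dotr a (k *: delta_mx 0 i) = k * a i.
Proof.
rewrite /dotr (bigD1 i) //= big1 ?addr0; first by rewrite !mxE !eqxx mulr1 mulrC.
by move=> j ji; rewrite !mxE (negbTE ji) andbF !mulr0.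
Qed.

End RowFunctionals.

Section CubeCross.
Variables (R : realType) (d : nat).
Local Notation norm1 y := (\sum_i `|y ord0 i|).

Definition sign_row (J : {set 'I_d}) : 'rV[R]_d := \row_i (-1) ^+ (i \in J).

Lemma sign_row_inj : injective sign_row.
Proof.
move=> J J' e; apply/setP => i; have := congr1 (fun y : 'rV_d => y 0 i) e.
by rewrite !mxE => /signr_inj.
Qed.

Lemma dotr_le_norm1 (u y : 'rV[R]_d) : @cube R d u -> \sum_i u 0 i * y 0 i <= norm1 y.
Proof.
move=> cu; apply: ler_sum => i _; apply: le_trans (ler_norm _) _.
by rewrite normrM -[leRHS]mul1r ler_wpM2r // ler_norml cu.
Qed.

(** The supremum defining the polar of the cube is attained at the vector of
    signs of [y]. *)
Lemma crossP (y : 'rV[R]_d) : @cross_polytope R d y <-> norm1 y <= 1.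
Proof.
split=> [|y1 u /dotr_le_norm1/le_trans]; last exact.
move=> /(_ (sign_row [set i | y 0 i < 0])).
have -> : \sum_i sign_row [set i | y 0 i < 0] 0 i * y 0 i = norm1 y.
  by apply: eq_bigr => i _; rewrite mxE inE -normrEsign.
by apply=> i; rewrite mxE; case: (i \in _); rewrite ?expr0 ?expr1; lra.
Qed.

Let scaling (y : 'rV[R]_d) : 0 < 1 + norm1 y.
Proof. by rewrite ltr_pwDl // sumr_ge0. Qed.

Let norm1_scale k (y : 'rV[R]_d) : norm1 (k *: y) = `|k| * norm1 y.
Proof. by rewrite mulr_sumr; apply: eq_bigr => i _; rewrite mxE normrM. Qed.

Let coord_norm1 (y : 'rV[R]_d) i : `|y 0 i| <= norm1 y.
Proof. by rewrite (bigD1 i) //= lerDl sumr_ge0. Qed.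

Let shrink (y : 'rV[R]_d) : norm1 ((1 + norm1 y)^-1 *: y) <= 1.
Proof.
have y_gt0 := scaling y; rewrite norm1_scale ger0_norm ?invr_ge0 ?(ltW y_gt0) //.
by rewrite ler_pdivrMl // mulr1; lra.
Qed.

Lemma cube_conv_hull : conv_hull (@cube R d) `<=` @cube R d.
Proof.
move=> y [n [p [c [pc c0 c1 ->]]]] i; rewrite summxE.
under eq_bigr do rewrite mxE.
rewrite -c1 -sumrN; apply/andP; split; apply: ler_sum => k _;
  have := c0 k; have /andP[] := pc k i; nra.
Qed.

Lemma cross_conv_hull : conv_hull (@cross_polytope R d) `<=` @cross_polytope R d.
Proof.
move=> y [n [p [c [pc c0 c1 ->]]]] u cu.
under eq_bigr do rewrite summxE mulr_sumr.
rewrite exchange_big /= -c1; apply: ler_sum => k _.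
under eq_bigr do rewrite mxE mulrCA.
by rewrite -mulr_sumr ler_piMr // pc.
Qed.

(** The weights are the probabilities of independent random signs with
    expectations [y 0 i]. *)
Lemma cube_sub_hull : @cube R d `<=` conv_hull (range sign_row).
Proof.
move=> y cy; pose c (J : {set 'I_d}) : R :=
  \prod_i if i \in J then (1 - y 0 i) / 2 else (1 + y 0 i) / 2.
have c0 J : 0 <= c J.
  by apply: prodr_ge0 => i _; have /andP[] := cy i; case: ifP => _ *; lra.
have c1 : \sum_J c J = 1.
  by rewrite -bigA_distr big1 // => i _ /=; field.
suff -> : y = \sum_J c J *: sign_row J by exact: family_conv_hull.
apply/rowP => i; rewrite summxE.
transitivity (\sum_(J : {set 'I_d}) \prod_j
   if j \in J then (if j == i then - (1 - y 0 j) / 2 else (1 - y 0 j) / 2)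
   else (1 + y 0 j) / 2).
  rewrite -bigA_distr (bigD1 i) //= eqxx big1 => [|j /negbTE -> /=]; first by field.
  by field.
apply: eq_bigr => J _; rewrite !mxE /c (bigD1 i) //= [in RHS](bigD1 i) //= eqxx.
rewrite mulrAC; congr (_ * _); first by case: (i \in J); rewrite ?expr0 ?expr1; field.
by apply: eq_bigr => j /negbTE ->.
Qed.

Definition signed_axis (x : 'I_d * bool) : 'rV[R]_d := (-1) ^+ x.2 *: delta_mx 0 x.1.

Lemma signed_axis_inj : injective signed_axis.
Proof.
move=> [i b] [j b'] e; have := congr1 (fun y : 'rV_d => y 0 i) e.
rewrite !mxE !eqxx mulr1 /=; have [<-|ij] := eqVneq i j.
  by rewrite mulr1 => /signr_inj ->.
by rewrite mulr0 => /eqP; rewrite signr_eq0.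
Qed.

(** Each coordinate puts its absolute value on one of its two signed axes; the
    remaining mass is spread evenly over all of them, where it cancels. *)
Lemma cross_sub_hull : (0 < d)%N ->
  @cross_polytope R d `<=` conv_hull (range signed_axis).
Proof.
move=> d_gt0 y /crossP y1; have d0 : (d%:R : R) != 0 by rewrite pnatr_eq0 -lt0n.
pose c (x : 'I_d * bool) : R :=
  (`|y 0 x.1| + (-1) ^+ x.2 * y 0 x.1) / 2 + (1 - norm1 y) / (2 * d%:R).
have sum_pair (M : nmodType) (F : 'I_d * bool -> M) :
    \sum_x F x = \sum_i (F (i, true) + F (i, false)).
  transitivity (\sum_i \sum_b F (i, b)).
    by rewrite pair_bigA; apply: eq_bigr => -[].
  by apply: eq_bigr => i _; rewrite big_bool.
have c0 x : 0 <= c x.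
  rewrite /c addr_ge0 // divr_ge0 ?mulr_ge0 ?subr_ge0 //.
  case: x => i [] /=; rewrite ?expr0 ?expr1.
    by have := ler_norm (y 0 i); lra.
  by have := ler_norm (- y 0 i); rewrite normrN; lra.
have c1 : \sum_x c x = 1.
  rewrite sum_pair (eq_bigr (fun i => `|y 0 i| + (1 - norm1 y) / d%:R)).
    by rewrite big_split /= sumr_const card_ord -mulr_natr; field.
  by move=> i _; rewrite /c /= expr0 expr1; field.
suff -> : y = \sum_x c x *: signed_axis x by exact: family_conv_hull.
rewrite sum_pair [LHS]row_sum_delta; apply: eq_bigr => i _.
by rewrite !scalerA -scalerDl /c /= expr0 expr1; congr (_ *: _); field.
Qed.

Definition cube_side (x : 'I_d * bool) : set 'rV[R]_d :=
  @cube R d `&` [set y | dotr (fun i => (i == x.1)%:R * (-1) ^+ x.2) y = 1].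

Let dotr1 i (k : R) (y : 'rV[R]_d) : dotr (fun j => (j == i)%:R * k) y = k * y 0 i.
Proof.
rewrite /dotr (bigD1 i) //= big1 => [|j /negbTE ->]; last by rewrite !mul0r.
by rewrite eqxx mul1r addr0.
Qed.

Lemma norm1_cube (y : 'rV[R]_d) : norm1 y <= 1 -> @cube R d y.
Proof. by move=> y1 i; rewrite -ler_norml (le_trans (coord_norm1 y i)). Qed.

Lemma cube_facet x : facets (@cube R d) (cube_side x).
Proof.
case: x => i b; have s1 : `|(-1) ^+ b : R| = 1 by rewrite normr_sign.
have ss : (-1) ^+ b * (-1) ^+ b = 1 :> R by rewrite -expr2 sqrr_sign.
have delta_norm : norm1 (signed_axis (i, b)) = 1.
  rewrite norm1_scale s1 mul1r (bigD1 i) //= big1 ?mxE ?eqxx ?normr1 ?addr0 //.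
  by move=> j ji; rewrite mxE (negbTE ji) andbF normr0.
apply: (@hyperplane_facet _ _ _ 0 (signed_axis (i, b)) (signed_axis (i, b))).
- by move=> j; rewrite mxE; lra.
- move=> y; exists (1 + norm1 y)^-1; first by rewrite invr_gt0.
  by rewrite add0r subr0; apply/norm1_cube/shrink.
- move=> y cy; rewrite /= dotr1; apply: le_trans (ler_norm _) _.
  by rewrite normrM s1 mul1r ler_norml cy.
- by apply: norm1_cube; rewrite delta_norm.
- by rewrite /= dotr1 !mxE !eqxx mulr1.
- by rewrite /= dotr1 !mxE !eqxx mulr1 ss oner_eq0.
move=> y; rewrite /= dotr1 => yi; exists (1 + norm1 y)^-1; first by rewrite invr_gt0.
move=> j; rewrite !mxE /=; have [->|ji] := eqVneq j i.
  have -> : y 0 i = (-1) ^+ b by rewrite -[LHS]mul1r -[in LHS]ss -mulrA yi mulr1.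
  by rewrite mulr1 subrr mulr0 addr0 -ler_norml s1.
rewrite ?andbF !mulr0 add0r subr0 -ler_norml.
by have := coord_norm1 ((1 + norm1 y)^-1 *: y) j; rewrite mxE => /le_trans; apply; exact: shrink.
Qed.

Lemma cube_side_inj : injective cube_side.
Proof.
move=> [i b] [j b'] e.
have : cube_side (i, b) (signed_axis (i, b)).
  split.
    move=> k; rewrite !mxE /=; case: (k == i); case: b {e}; rewrite ?expr0 ?expr1 /=; lra.
  by rewrite /= dotr1 !mxE !eqxx mulr1 -expr2 sqrr_sign.
rewrite e => -[_ /=]; rewrite dotr1 !mxE eqxx /=.
have [->|ji] := eqVneq j i; last by rewrite !mulr0 => /eqP; rewrite eq_sym oner_eq0.
rewrite mulr1; case: b {e}; case: b'; rewrite ?expr0 ?expr1 // => h; exfalso; move: h; lra.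
Qed.

Lemma cube_vertex J : vertices (@cube R d) (sign_row J).
Proof.
have ss (b : bool) : (-1) ^+ b * (-1) ^+ b = 1 :> R by rewrite -expr2 sqrr_sign.
have le1 y i : @cube R d y -> sign_row J 0 i * y 0 i <= 1.
  move=> cy; apply: le_trans (ler_norm _) _.
  by rewrite mxE normrM normr_sign mul1r ler_norml cy.
exists (dotr (sign_row J 0)), (\sum_(i < d) 1); split.
  by move=> y cy; apply: ler_sum => i _; exact: le1.
apply/seteqP; split=> y /=.
  move=> ->; split=> [i|]; first by rewrite mxE; case: (i \in J); rewrite ?expr0 ?expr1; lra.
  by apply: eq_bigr => i _; rewrite mxE ss.
move=> [cy /eqP]; rewrite eq_sym -subr_eq0 /dotr -sumrB => /eqP s0.
have gap_ge0 i : true -> 0 <= 1 - sign_row J 0 i * y 0 i.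
  by move=> _; rewrite subr_ge0 le1.
apply/rowP => i; have /eqP := psumr_eq0P gap_ge0 s0 (isT : true) (i := i).
by rewrite subr_eq0 mxE => /eqP yi; rewrite -[LHS]mul1r -[in LHS](ss (i \in J)) -mulrA -yi mulr1.
Qed.

Definition cross_side (J : {set 'I_d}) : set 'rV[R]_d :=
  @cross_polytope R d `&` [set y | dotr (sign_row J 0) y = 1].

Lemma cross_facet J : (0 < d)%N -> facets (@cross_polytope R d) (cross_side J).
Proof.
move=> d_gt0; have dR : 0 < d%:R :> R by rewrite ltr0n.
have d0 : (d%:R : R) != 0 by rewrite lt0r_neq0.
pose i0 : 'I_d := Ordinal d_gt0.
have ss i : sign_row J 0 i * sign_row J 0 i = 1 by rewrite mxE -expr2 sqrr_sign.
have dotc : dotr (sign_row J 0) (d%:R^-1 *: sign_row J) = 1.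
  rewrite /dotr (eq_bigr (fun=> d%:R^-1)) => [|i _]; last by rewrite [X in _ * X]mxE mulrCA ss mulr1.
  by rewrite sumr_const card_ord -[LHS]mulr_natr mulVf.
have cube_sign : @cube R d (sign_row J).
  by move=> i; rewrite mxE -ler_norml normr_sign.
apply: (@hyperplane_facet _ _ _ 0 (d%:R^-1 *: sign_row J) (d%:R^-1 *: sign_row J)).
- by apply/crossP; rewrite big1 // => i _; rewrite mxE normr0.
- move=> y; exists (1 + norm1 y)^-1; first by rewrite invr_gt0.
  by rewrite add0r subr0; apply/crossP/shrink.
- by move=> y /(_ _ cube_sign).
- apply/crossP; rewrite norm1_scale ger0_norm ?invr_ge0 ?ler0n //.
  rewrite (eq_bigr (fun=> 1)) => [|i _]; last by rewrite mxE normr_sign.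
  by rewrite sumr_const card_ord mulVf.
- exact: dotc.
- by rewrite /= dotc oner_eq0.
move=> y yJ; have n_ge0 : 0 <= norm1 y by exact: sumr_ge0.
have D_gt0 : 0 < 1 + d%:R * norm1 y by rewrite ltr_pwDl // mulr_ge0 // ltW.
pose e := (1 + d%:R * norm1 y)^-1; exists e; first by rewrite invr_gt0.
set z := _ + _; apply/crossP.
(* This value of [e] makes each coordinate of [z] keep the sign given by [J]. *)
have e_le : e * norm1 y <= (1 - e) / d%:R.
  by rewrite le_eqVlt; apply/orP; left; apply/eqP; rewrite /e; field; rewrite d0 lt0r_neq0.
suff zJ i : `|z 0 i| = sign_row J 0 i * z 0 i.
  under eq_bigr do rewrite zJ.
  have -> : \sum_i sign_row J 0 i * z 0 i = dotr (sign_row J 0) z by [].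
  by rewrite /z linearD /= dotc linearZ linearB /= dotc yJ subrr scaler0 addr0.
have sJ : `|sign_row J 0 i| = 1 by rewrite mxE normr_sign.
have -> : `|z 0 i| = `|sign_row J 0 i * z 0 i| by rewrite normrM sJ mul1r.
apply: ger0_norm; rewrite !mxE.
set s := (-1) ^+ _; have {}ss : s * s = 1 by rewrite /s -expr2 sqrr_sign.
have -> : s * (d%:R^-1 * s + e * (y 0 i - d%:R^-1 * s)) =
   (s * s) * ((1 - e) / d%:R) + e * (s * y 0 i) by field.
rewrite ss mul1r.
have : - (s * y 0 i) <= norm1 y.
  apply: le_trans (coord_norm1 y i); apply: le_trans (ler_norm _) _.
  by rewrite normrN normrM /s normr_sign mul1r.
have e_gt0 : 0 < e by rewrite invr_gt0.
by move=> /(ler_wpM2l (ltW e_gt0)); rewrite mulrN; lra.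
Qed.

Lemma cross_side_inj : (0 < d)%N -> injective cross_side.
Proof.
move=> d_gt0 J J' e; apply/setP => i.
have axis_in (K : {set 'I_d}) : cross_side K (signed_axis (i, i \in K)).
  split; last first.
    by rewrite /= dotr_delta mxE -expr2 sqrr_sign.
  apply/crossP; rewrite norm1_scale normr_sign mul1r (bigD1 i) //= big1.
    by rewrite mxE !eqxx normr1 addr0.
  by move=> j ji; rewrite mxE (negbTE ji) andbF normr0.
have := axis_in J; rewrite e => -[_ /=]; rewrite dotr_delta mxE.
by case: (i \in J); case: (i \in J'); rewrite ?expr0 ?expr1 // => h; exfalso; move: h; lra.
Qed.

Lemma cross_vertex x : vertices (@cross_polytope R d) (signed_axis x).
Proof.
case: x => i b; have ss : (-1) ^+ b * (-1) ^+ b = 1 :> R by rewrite -expr2 sqrr_sign.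
exists (dotr (fun j => (j == i)%:R * (-1) ^+ b)), 1; split.
  move=> y /crossP y1; rewrite /= dotr1; apply: le_trans (ler_norm _) _.
  by rewrite normrM normr_sign mul1r (le_trans (coord_norm1 y i)).
apply/seteqP; split=> y /=.
  move=> ->; split; last by rewrite /= dotr1 !mxE !eqxx mulr1 ss.
  apply/crossP; rewrite norm1_scale normr_sign mul1r (bigD1 i) //= big1.
    by rewrite mxE !eqxx normr1 addr0.
  by move=> j ji; rewrite mxE (negbTE ji) andbF normr0.
move=> [/crossP y1]; rewrite /= dotr1 => yi.
have yiE : y 0 i = (-1) ^+ b by rewrite -[LHS]mul1r -[in LHS]ss -mulrA yi mulr1.
apply/rowP => j; rewrite !mxE /=; have [->|ji] := eqVneq j i.
  by rewrite yiE mulr1.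
move: y1; rewrite (bigD1 i) //= yiE normr_sign (bigD1 j) //=.
set r := \sum_(_ | _) _; have r_ge0 : 0 <= r by exact: sumr_ge0.
by move=> h; rewrite mulr0; apply/eqP; rewrite -normr_le0; lra.
Qed.

End CubeCross.

Import mathcomp.boot.fintype mathcomp.boot.finset.
Local Open Scope classical_set_scope.

(** * Coordinates and dimension of the cut polytope *)

Section CutPolytope.
Variables (R : realType) (G : graph).
Local Notation V := (vertex_set G).
Local Notation E := (edge_set G).
Local Notation W := {ffun E -> R^o}.
Local Notation P := (@CUT R G).
Local Notation x := (fun S : {set V} => char_vec R (cut S) : W).
Implicit Types (S : {set V}) (A Y : {set {set V}}) (p : {set V}) (e : E).

Definition edge_pair e : {set V} := [set (ends e).1; (ends e).2].

(** Parallel edges give the same pair, and loops give none: these pairs are the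
    essentially different coordinates of the cut polytope. *)
Definition edge_pairs : {set {set V}} :=
  [set edge_pair e | e in [pred e | (ends e).1 != (ends e).2]]%SET.
Local Notation D := edge_pairs.

Definition pattern S : {set {set V}} := [set p in D | odd #|p :&: S|]%SET.

Lemma card_edge_pair p : p \in D -> #|p| = 2%N.
Proof. by case/imsetP => e; rewrite inE => uv ->; rewrite cards2 uv. Qed.

Lemma edge_of_pair p : p \in D -> exists e, edge_pair e = p.
Proof. by case/imsetP => e _ ->; exists e. Qed.

Lemma set0_notin_edge_pairs : set0 \notin D.
Proof. by apply/negP => /card_edge_pair; rewrite cards0. Qed.

Lemma pattern_sub S : pattern S \subset D.
Proof. by apply/subsetP => p; rewrite inE => /andP[]. Qed.

Lemma walsh_pattern p S : p \in D -> walsh R p S = (-1) ^+ (p \in pattern S).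
Proof. by move=> pD; rewrite walsh_card inE pD signr_odd. Qed.

Lemma mem_pattern p S : p \in D -> (p \in pattern S)%:R = (1 - walsh R p S) / 2.
Proof. by move=> pD; rewrite walsh_pattern //; case: (_ \in _) => /=; lra. Qed.

(** This also covers a loop, whose pair is a singleton and so is outside of
    [edge_pairs]. *)
Lemma mem_cut e S : (e \in cut S) = (edge_pair e \in pattern S).
Proof.
have [uv|uv] := eqVneq (ends e).1 (ends e).2.
  rewrite inE uv addbb; apply/esym/negP => /(subsetP (pattern_sub S))/card_edge_pair.
  by rewrite /edge_pair uv setUid cards1.
have eD : edge_pair e \in D by apply/imsetP; exists e; rewrite ?inE.
apply: (@signr_inj R); rewrite -walsh_pattern // walsh_pair 1?eq_sym //.
by rewrite inE signr_addb.
Qed.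
Definition pair_vec p : W := [ffun e => (edge_pair e == p)%:R].

Definition vec_of (y : {set V} -> R) : W := \sum_(p in D) (y p : R) *: pair_vec p.

Lemma vec_ofE y e : vec_of y e = if edge_pair e \in D then y (edge_pair e) else 0.
Proof.
rewrite /vec_of sum_ffunE; under eq_bigr do rewrite !ffunE.
case: ifP => eD.
  rewrite (bigD1 (edge_pair e)) //= eqxx big1 => [|p /andP[_ /negbTE pe]].
    by rewrite addr0 /GRing.scale /= mulr1.
  by rewrite eq_sym pe scaler0.
apply: big1 => p pD; case: eqP => [ep|]; last by rewrite scaler0.
by rewrite ep pD in eD.
Qed.

Definition pattern_vec (A : {set {set V}}) : W := vec_of (fun p => (p \in A)%:R).

Lemma char_vec_pattern S : x S = pattern_vec (pattern S).
Proof.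
apply/ffunP => e; rewrite vec_ofE ffunE mem_cut; case: ifP => // /negbT eD.
by rewrite (contraNF (subsetP (pattern_sub S) _) eD).
Qed.

Definition pair_basis : #|D|.-tuple W := [tuple pair_vec (enum_val i) | i < #|D|].

Lemma vec_of_span y : vec_of y \in <<pair_basis>>%VS.
Proof.
rewrite rpred_sum // => p pD; rewrite rpredZ // memv_span //.
by apply/mapP; exists (enum_rank_in pD p); rewrite ?mem_enum // enum_rankK_in.
Qed.

Lemma span_vec_of w : w \in <<pair_basis>>%VS -> exists y, w = vec_of y.
Proof.
move=> /coord_span wE.
exists (fun p => \sum_(i < #|D|) if enum_val i == p then coord pair_basis i w else 0).
rewrite {1}wE /vec_of [RHS]big_enum_val; apply: eq_bigr => i _.
rewrite (nth_map i) ?size_enum_ord // nth_ord_enum (bigD1 i) //= eqxx big1 ?addr0 //.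
by move=> j ji; rewrite (inj_eq enum_val_inj) (negbTE ji).
Qed.

Lemma pair_basis_free : free pair_basis.
Proof.
apply/freeP => k k0 i.
have iD : enum_val i \in D by exact: enum_valP.
have [e ei] := edge_of_pair iD.
have := congr1 (fun w : W => w e) k0.
rewrite sum_ffunE !ffunE (bigD1 i) //= big1 => [|j ji].
  rewrite (nth_map i) ?size_enum_ord // nth_ord_enum !ffunE ei eqxx addr0.
  by rewrite /GRing.scale /= mulr1.
rewrite (nth_map i) ?size_enum_ord // nth_ord_enum !ffunE ei.
by rewrite (inj_eq enum_val_inj) eq_sym (negbTE ji) scaler0.
Qed.

Lemma CUT_vec_of w : P w -> exists y, w = vec_of y.
Proof.
move=> /conv_hull_family[c [_ _ ->]]; apply: span_vec_of.
by rewrite rpred_sum // => S _; rewrite rpredZ // char_vec_pattern vec_of_span.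
Qed.

Lemma CUT_eq w1 w2 : P w1 -> P w2 ->
  (forall p, p \in D -> exists2 e, edge_pair e = p & w1 e = w2 e) -> w1 = w2.
Proof.
move=> /CUT_vec_of[y1 ->] /CUT_vec_of[y2 ->] y12; apply: eq_bigr => p pD.
have [e ep] := y12 p pD; rewrite !vec_ofE ep pD => ->; by [].
Qed.

(** Orthogonality of the characters gives the affine coefficients explicitly: for
    the target coordinates [y], take the function of [S] whose Fourier
    coefficients are [1] at the empty set and [1 - 2 * y p] at the pair [p]. *)
Lemma aff_hull_CUT : aff_hull P = translate 0 [set` <<pair_basis>>%VS].
Proof.
apply/seteqP; split=> w.
  move=> [n [q [c [qP c1 ->]]]]; exists (\sum_i c i *: q i); rewrite /= ?add0r //.
  rewrite rpred_sum // => i _; rewrite rpredZ //.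
  by have [y ->] := CUT_vec_of (qP i); exact: vec_of_span.
move=> [u /= /span_vec_of[y ->] <-]; rewrite add0r.
pose a p : R := if p == set0 then 1 else if p \in D then 1 - 2 * y p else 0.
pose c S : R := (2 ^+ #|V|)^-1 * \sum_p a p * walsh R p S.
have two0 : (2 : R) ^+ #|V| != 0 by rewrite expf_neq0 // pnatr_eq0.
have cE p : \sum_S c S * walsh R p S = a p.
  under eq_bigr do rewrite /c -mulrA.
  by rewrite -mulr_sumr walsh_coeff mulrC mulfK.
have c1 : \sum_S c S = 1.
  rewrite (eq_bigr (fun S => c S * walsh R set0 S)); first by rewrite cE /a eqxx.
  by move=> S _; rewrite walsh0 mulr1.
suff -> : vec_of y = \sum_S c S *: x S by exact: family_aff_hull.
under [RHS]eq_bigr do rewrite char_vec_pattern /pattern_vec /vec_of scaler_sumr.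
rewrite exchange_big; apply: eq_bigr => p pD /=.
under [RHS]eq_bigr do rewrite scalerA.
rewrite -scaler_suml; congr (_ *: _).
under [RHS]eq_bigr do rewrite mem_pattern // mulrA mulrBr mulr1.
rewrite -mulr_suml sumrB c1 cE /a pD.
case: eqP => [p0|_]; last by field.
by move: pD; rewrite p0 (negbTE set0_notin_edge_pairs).
Qed.

Lemma aff_dim_CUT : aff_dim P = #|D|.
Proof.
by rewrite (aff_dimE aff_hull_CUT) (eqP pair_basis_free) size_tuple.
Qed.

(** * Vertices of the cut polytope *)
Definition dotw (a : E -> R) (w : W) : R^o := \sum_e a e * w e.

Fact dotw_linear a : linear (dotw a).
Proof.
move=> k v w; rewrite /dotw scaler_sumr -big_split /=; apply: eq_bigr => e _.
by rewrite !ffunE mulrDr mulrCA.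
Qed.

HB.instance Definition _ a := GRing.isLinear.Build R W R^o _ (dotw a) (dotw_linear a).

(** The point of [S] is the unique maximizer, over 0/1 vectors, of the functional
    with coefficients [1] on the cut of [S] and [-1] elsewhere. *)
Lemma vertices_CUT : vertices P = range x.
Proof.
apply/seteqP; split=> w; first by move=> /vertex_family[S ->]; exists S.
move=> [S _ <-]; rewrite /vertices /=.
pose l := dotw (fun e => 2 * x S e - 1).
have term_le T e : (2 * x S e - 1) * x T e <= x S e.
  by rewrite !ffunE; do 2 case: (e \in _) => /=; lra.
have lP w' : P w' -> l w' <= \sum_e x S e.
  apply: linear_conv_hull_le => T /=; rewrite /l /dotw.
  by apply: ler_sum => e _; exact: term_le.
have fF : face P (P `&` [set w' | l w' = \sum_e x S e]) by exists l, (\sum_e x S e).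
rewrite (_ : [set x S] = P `&` [set w' | l w' = \sum_e x S e]) //.
apply/seteqP; split=> w'.
  move=> ->; split; first by apply: sub_conv_hull; exists S.
  by apply: eq_bigr => e _; rewrite !ffunE; case: (e \in _) => /=; lra.
move=> Fw'; have [c [c0 c1 -> cF]] := face_family fF Fw'.
rewrite (eq_bigr (fun T => c T *: x S)); first by rewrite -scaler_suml c1 scale1r.
move=> T _; have [->|/cF[_ /= lT]] := eqVneq (c T) 0; first by rewrite !scale0r.
congr (_ *: _); apply/ffunP => e.
have gap_ge0 e' : true -> 0 <= x S e' - (2 * x S e' - 1) * x T e'.
  by move=> _; rewrite subr_ge0 term_le.
have gap0 : \sum_e (x S e - (2 * x S e - 1) * x T e) = 0.
  by rewrite sumrB -lT subrr.
have := psumr_eq0P gap_ge0 gap0 (isT : true) (i := e).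
by rewrite !ffunE; do 2 case: (e \in _) => /=; lra.
Qed.

Definition patterns : {set {set {set V}}} := [set pattern S | S in [set: {set V}]]%SET.

Lemma patterns_sub : patterns \subset powerset D.
Proof. by apply/subsetP => _ /imsetP[S _ ->]; rewrite inE pattern_sub. Qed.

Lemma pattern_vec_inj A A' : A \subset D -> A' \subset D ->
  pattern_vec A = pattern_vec A' -> A = A'.
Proof.
move=> AD A'D e; apply/setP => p; case: (boolP (p \in D)) => pD; last first.
  by rewrite (contraNF (subsetP AD p)) // (contraNF (subsetP A'D p)).
have [f fp] := edge_of_pair pD.
have := congr1 (fun w : W => w f) e; rewrite !vec_ofE fp pD.
by case: (p \in A); case: (p \in A') => //= h; exfalso; move: h; lra.
Qed.

Lemma vertices_patterns : vertices P = [set pattern_vec A | A in [set` patterns]].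
Proof.
rewrite vertices_CUT; apply/seteqP; split=> w.
  move=> [S _ <-]; exists (pattern S); last by rewrite char_vec_pattern.
  by apply/imsetP; exists S.
by move=> [_ /imsetP[S _ ->] <-]; exists S; rewrite ?char_vec_pattern.
Qed.

Lemma finite_vertices_CUT : finite_set (vertices P).
Proof. by rewrite vertices_patterns; apply: finite_image; exact: finite_finset. Qed.

Lemma nb_vertices_CUT : nb_vertices P = #|patterns|.
Proof.
apply/eqP; rewrite eqn_leq; apply/andP; split.
  suff sub : vertices P `<=` [set pattern_vec A | A in [set` patterns]].
    by have [] := fset_set_card_le sub.
  by rewrite vertices_patterns.
apply: (@card_le_fset_set _ _ _ _ pattern_vec finite_vertices_CUT).
  move=> A A' /(subsetP patterns_sub) + /(subsetP patterns_sub).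
  by rewrite !inE; exact: pattern_vec_inj.
by move=> A AP; rewrite vertices_patterns; exists A.
Qed.

(** * Facets of a 2-level cut polytope *)

Lemma linear_char_vec (l : {linear W -> R^o}) S :
  l (x S) = \sum_(p in D) l (pair_vec p) * ((1 - walsh R p S) / 2) :> R.
Proof.
rewrite /= char_vec_pattern /pattern_vec /vec_of linear_sum; apply: eq_bigr => p pD.
by rewrite linearZ mulrC -mem_pattern.
Qed.

Lemma CUT_char_vec S : P (x S).
Proof. by apply: sub_conv_hull; exists S. Qed.

Lemma face_CUT_proper F : face P F -> F <> P -> exists S, ~ F (x S).
Proof.
move=> fF FP; apply: contrapT => /forallNP h; apply: FP.
apply/seteqP; split; first exact: faceS.
have fP : face P P.
  exists (dotw (fun=> 0)), 0; split=> [w _|].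
    by rewrite /= /dotw big1 // => e _; rewrite mul0r.
  apply/seteqP; split=> [w Pw|w []//]; split=> //=.
  by rewrite /dotw big1 // => e _; rewrite mul0r.
by apply: (face_eq fP fF) => S _; apply: contrapT; exact: h.
Qed.

(** In a 2-level polytope the functional of a facet takes a single value on the
    vertices outside of the facet, so that it can be normalized to the 0/1
    indicator of these vertices. *)
Lemma facet_indicator F : two_level P -> facets P F ->
  exists a : {set V} -> R,
  [/\ forall p, a p != 0 -> p = set0 \/ p \in D,
      forall S, F (x S) -> \sum_p a p * walsh R p S = 0,
      forall S, ~ F (x S) -> \sum_p a p * walsh R p S = 1,
      exists S, F (x S) & exists S, ~ F (x S)].
Proof.
move=> P2 facF; have [fF [y Fy] dimF] := facF.
have [S1 FS1] : exists S, ~ F (x S).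
  by apply: face_CUT_proper => // FP; move: dimF; rewrite FP => /esym/n_Sn.
have [S0 FS0] : exists S, F (x S).
  have [c [c0 c1 _ cF]] := face_family fF Fy.
  suff /existsP[S cS] : [exists S, c S != 0] by exists S; exact: cF.
  apply: contraPT c1 => /existsPn h; rewrite big1 => [/eqP|S _].
    by rewrite eq_sym oner_eq0.
  by apply/eqP; have := h S; rewrite negbK.
have [t tF] := P2 _ facF; have [l [b [lP FE]]] := fF.
have lF S : F (x S) <-> l (x S) = b.
  by rewrite FE; split=> [[]//|]; split=> //; exact: CUT_char_vec.
have lNF S : ~ F (x S) -> l (x S) = b + l t.
  move=> NF; have [|w wF <-] := tF (x S).
    by split=> //; rewrite vertices_CUT; exists S.
  rewrite linearD addrC; congr (_ + _).
  by apply: (@linear_aff_hull _ _ l b F) => // z; rewrite FE => -[].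
have lt0 : l t != 0.
  by apply/eqP => lt0; apply/FS1/lF; have := lNF _ FS1; rewrite lt0 addr0.
pose L p : R := l (pair_vec p).
pose k : R := (l t)^-1.
exists (fun p => if p == set0 then k * (2^-1 * (\sum_(q in D) L q) - b)
            else if p \in D then - (k * L p / 2) else 0).
have sumE S : \sum_p (if p == set0 then k * (2^-1 * (\sum_(q in D) L q) - b)
            else if p \in D then - (k * L p / 2) else 0) * walsh R p S =
    k * (l (x S) - b).
  rewrite (bigD1 set0) //= eqxx walsh0 mulr1.
  have -> : \sum_(p | p != set0) (if p == set0 then k * (2^-1 * (\sum_(q in D) L q) - b)
      else if p \in D then - (k * L p / 2) else 0) * walsh R p S =
      \sum_(p in D) - (k * L p / 2) * walsh R p S.
    rewrite [LHS]big_mkcond [RHS]big_mkcond; apply: eq_bigr => p _ /=.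
    case: eqP => [->|_] /=; first by rewrite (negbTE set0_notin_edge_pairs).
    by case: ifP => // _; rewrite mul0r.
  rewrite linear_char_vec !mulrBr addrAC; congr (_ - _).
  rewrite !mulr_sumr -big_split; apply: eq_bigr => p pD /=.
  by rewrite -/(L p); field.
split.
- move=> p; case: ifP => [/eqP|_]; first by left.
  by case: ifP => [pD _|_]; [right|rewrite eqxx].
- by move=> S /lF lS; rewrite sumE lS subrr mulr0.
- by move=> S /lNF lS; rewrite sumE lS addrAC subrr add0r mulVf.
- by exists S0.
- by exists S1.
Qed.

Lemma fixed_walsh_face p (b : bool) : p \in D ->
  exists F', face P F' /\ (forall S, F' (x S) <-> walsh R p S = (-1) ^+ b).
Proof.
move=> pD; have [f fp] := edge_of_pair pD.
pose l : {linear W -> R^o} := dotw (fun e => (e == f)%:R * - (-1) ^+ b).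
have lE w : l w = - (-1) ^+ b * w f :> R.
  rewrite /l /= /dotw (bigD1 f) //= big1 => [|e /negbTE ->].
    by rewrite eqxx mul1r addr0.
  by rewrite !mul0r.
have lx S : l (x S) = - (-1) ^+ b * ((1 - walsh R p S) / 2) :> R.
  by rewrite lE !ffunE mem_cut fp mem_pattern.
have ws S : walsh R p S = 1 \/ walsh R p S = -1.
  by rewrite walsh_pattern //; case: (_ \in _); [right|left].
exists (P `&` [set w | l w = (b%:R : R)]); split.
  exists l, b%:R; split=> //; apply: linear_conv_hull_le => S.
  rewrite lx; case: (ws S) => ->; case: b {l lE lx} => /=; lra.
move=> S; split=> [[_ /= lS]|h].
  have {lS} : l (x S) = b%:R :> R by exact: lS.
  rewrite lx; case: (ws S) => ->; case: b {l lE lx} => //= h; exfalso; move: h; lra.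
split; first exact: CUT_char_vec.
suff : l (x S) = b%:R :> R by [].
by rewrite lx h; case: b {l lE lx h} => /=; lra.
Qed.

(** On such a facet all three terms are minimal, so [walsh p] is constant for
    each of the three pairs [p].  Fixing only one of these characters defines a
    proper face, which is strictly larger because a vertex of another pair can
    still be moved; this contradicts the maximality of facets. *)
Lemma facet_not_three_quarters F (a : {set V} -> R) (Y : {set {set V}}) :
  facets P F -> #|Y| = 3%N -> Y \subset D ->
  (forall p, p \in Y -> `|a p| = 1/4) -> (exists S, F (x S)) ->
  ~ (forall S, F (x S) <-> \sum_(p in Y) a p * walsh R p S = - (3/4)).
Proof.
move=> facF Y3 /subsetP YD aY [S0 FS0] FE.
have tight S p : F (x S) -> p \in Y -> a p * walsh R p S = - (1/4).
  move=> /FE sS pY.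
  have gap_ge0 q : q \in Y -> 0 <= 1/4 + a q * walsh R q S.
    move=> qY; have := ler_norm (- (a q * walsh R q S)).
    by rewrite normrN normrM walsh_sign normr_sign aY //; lra.
  have gap0 : \sum_(q in Y) (1/4 + a q * walsh R q S) = 0.
    rewrite big_split /= sS sumr_const Y3; lra.
  by have := psumr_eq0P gap_ge0 gap0 pY; lra.
have /card_gt2P[p [q [_ [[pY qY _] [pq _ _]]]]] : (2 < #|Y|)%N by rewrite Y3.
have [F' [fF' F'E]] := fixed_walsh_face (walsh R p S0 < 0)%R (YD _ pY).
have ap0 : a p != 0 by rewrite -normr_gt0 aY //; lra.
have aq0 : a q != 0 by rewrite -normr_gt0 aY //; lra.
have F'E' S : F' (x S) <-> walsh R p S = walsh R p S0.
  by rewrite [walsh R p S0]walsh_sign; exact: F'E.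
have cardp := card_edge_pair (YD _ pY); have cardq := card_edge_pair (YD _ qY).
have [u up] : exists u, u \in p by apply/set0Pn; rewrite -card_gt0 cardp.
have [v vq vp] : exists2 v, v \in q & v \notin p.
  by apply/subsetPn; apply: contra pq => qp; rewrite eq_sym eqEcard qp cardp cardq.
have FF' : F `<=` F'.
  have [fF _ _] := facF; apply: (face_eq fF fF') => S FS.
  by apply/F'E'; apply: (mulfI ap0); rewrite !tight.
have F'P : F' <> P.
  move=> F'P; have /F'E' : F' (x (toggle u S0)) by rewrite F'P; exact: CUT_char_vec.
  rewrite walsh_toggle up mulN1r walsh_pattern ?YD //; case: (_ \in _) => /=; clear; lra.
have F'F := facet_maximal facF fF' FF' F'P.
have : F (x (toggle v S0)) by rewrite -F'F; apply/F'E'; rewrite walsh_toggle (negbTE vp) mul1r.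
move=> /tight/(_ qY); rewrite walsh_toggle vq mulN1r mulrN tight //; lra.
Qed.

(** * Counting facets *)

(** A triple or quadruple of pairs that every cut meets evenly is a triangle or a
    quadrilateral of the graph. *)
Definition cycles : {set {set {set V}}} :=
  [set Y : {set {set V}} | [&& Y \subset D, (#|Y| == 3%N) || (#|Y| == 4%N) &
     [forall S, walsh R Y (pattern S) == 1]]]%SET.

(** A facet is encoded by the support [Y] of its indicator and the set [B] of pairs
    with positive coefficient; these determine all coefficients, through
    [code_coeff].  The parity condition says that the product of the signs is
    [1] for a triangle and [-1] for a quadrilateral. *)
Definition codes : {set {set {set V}} * {set {set V}}} :=
  [set c : {set {set V}} * {set {set V}} | [&& c.1 \subset D, c.2 \subset c.1 &
     (#|c.1| == 1%N) || (c.1 \in cycles) && odd #|c.2|]]%SET.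

Definition code_coeff (c : {set {set V}} * {set {set V}}) p : R :=
  if p == set0 then (if #|c.1| == 3%N then 1/4 else 1/2) else
  if p \in c.1 then (if #|c.1| == 1%N then 1/2 else 1/4) * (if p \in c.2 then 1 else -1)
  else 0.

Lemma prod_walsh_pattern Y S : Y \subset D ->
  \prod_(p in Y) walsh R p S = walsh R Y (pattern S).
Proof. by move=> /subsetP YD; apply: eq_bigr => p /YD; exact: walsh_pattern. Qed.

Lemma signed_prod (a : {set V} -> R) Y q :
  (forall p, p \in Y -> `|a p| = q) ->
  \prod_(p in Y) a p = q ^+ #|Y| * (-1) ^+ (odd #|Y| (+) odd #|[set p in Y | 0 < a p]%SET|).
Proof.
move=> aY; set B := [set p in Y | _]%SET.
have BY : B \subset Y by apply/subsetP => p; rewrite inE => /andP[].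
have -> : odd #|Y| (+) odd #|B| = odd #|Y :\: B|.
  by rewrite -(cardsID B Y) oddD (setIidPr BY) addbAC addbb.
transitivity (\prod_(p in Y) (q * (if p \in B then 1 else -1))).
  apply: eq_bigr => p pY; rewrite -(aY _ pY) inE pY /=.
  case: (ltrgt0P (a p)) => //= ap; rewrite ?mulr1 ?mulrN1 ?opprK //.
  by rewrite ap oppr0.
rewrite big_split prodr_const; congr (_ * _).
rewrite signr_odd -prodr_const [LHS]big_mkcond [RHS]big_mkcond.
by apply: eq_bigr => p _; rewrite !inE; case: (p \in Y); case: (_ < _)%R.
Qed.

Lemma facet_code F : two_level P -> facets P F ->
  exists2 c, c \in codes &
    forall S, F (x S) <-> \sum_p code_coeff c p * walsh R p S = 0.
Proof.
move=> P2 facF.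
have [a [a_D F0 F1 [S0 FS0] [S1 FS1]]] := facet_indicator P2 facF.
have FE S : F (x S) <-> \sum_p a p * walsh R p S = 0.
  split; first exact: F0.
  move=> s0; apply: contrapT => /F1; rewrite s0 => /eqP.
  by rewrite eq_sym oner_eq0.
have a_supp p : a p != 0 -> p = set0 \/ #|p| = 2%N.
  by move=> /a_D[->|/card_edge_pair]; [left|right].
have a_bool S : \sum_p a p * walsh R p S = 0 \/ \sum_p a p * walsh R p S = 1.
  by have [/F0|/F1] := pselect (F (x S)); [left|right].
pose Y := [set p | (p != set0) && (a p != 0)]%SET.
have aY p : p != set0 -> p \notin Y -> a p = 0.
  by move=> p0; rewrite inE p0 negbK => /eqP.
have YD : Y \subset D.
  by apply/subsetP => p; rewrite inE => /andP[/eqP p0 /a_D[]].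
have sumY S : \sum_p a p * walsh R p S = a set0 + \sum_(p in Y) a p * walsh R p S.
  rewrite (bigD1 set0) //= walsh0 mulr1; congr (_ + _).
  rewrite big_mkcond [RHS]big_mkcond; apply: eq_bigr => p _.
  case: ifP => [p0|/negbFE/eqP ->]; last by rewrite inE eqxx.
  by case: ifP => // /negbT pY; rewrite aY ?mul0r.
have [p pY] : exists p, p \in Y.
  apply/set0Pn; apply: contra_notN FS1 => /eqP Y0; apply/FE.
  by have := F0 _ FS0; rewrite !sumY Y0 !big_set0.
have [p0 ap] : p != set0 /\ a p != 0 by apply/andP; move: pY; rewrite inE.
pose B := [set p in Y | 0 < a p]%SET.
have BY : B \subset Y by apply/subsetP => q; rewrite inE => /andP[].
(* The support and the signs determine the indicator. *)
suff [cC [a0 aq]] : (Y, B) \in codes /\ a set0 = code_coeff (Y, B) set0 /\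
    forall q, q \in Y -> `|a q| = if #|Y| == 1%N then 1/2 else 1/4.
  exists (Y, B) => // S; rewrite FE.
  suff aE : a =1 code_coeff (Y, B).
    by rewrite (eq_bigr (fun q => code_coeff (Y, B) q * walsh R q S)) // => q _; rewrite aE.
  move=> q; have [->//|q0] := eqVneq q set0.
  rewrite /code_coeff (negbTE q0) /=; case: ifP => [qY|/negbT/(aY _ q0) //].
  rewrite -(aq _ qY) inE qY /=.
  case: (ltrgt0P (a q)) => aq0 /=; rewrite ?mulr1 ?mulrN1 ?opprK //.
  by rewrite aq0 oppr0.
have [v vp] := set0Pn _ p0.
have [_ [ap2|ap4]] := star_weights a_supp a_bool vp ap.
  have [YE a0] := single_edge_support a_supp a_bool p0 ap2.
  rewrite -/Y in YE; rewrite /codes /code_coeff inE /= YD BY eqxx YE cards1 /=.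
  by split=> //; split=> // q; rewrite inE => /eqP ->.
have [a4 prod1 card] := cycle_support a_supp a_bool p0 ap4.
rewrite -/Y in a4 prod1 card.
have walsh1 : [forall S, walsh R Y (pattern S) == 1].
  by apply/forallP => S; rewrite -prod_walsh_pattern // prod1.
have signs := signed_prod a4; rewrite -/B in signs.
case: card => [[Y3 a0]|[Y4 a0 prodY]].
  have oddB : odd #|B|.
    apply: contrapT => /negP evenB.
    apply: (@facet_not_three_quarters F a Y) => //; first by exists S0.
    move=> S; rewrite FE sumY a0 signs Y3 (negbTE evenB) /=.
    by move: (\sum_(_ in Y) _) => s; clear; split=> h; lra.
  rewrite /codes /cycles /code_coeff !inE /= YD BY Y3 /= walsh1 oddB eqxx.
  split=> //; split=> [|q qY]; last exact: a4.
  by rewrite a0 signs Y3 oddB /=; field.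
have oddB : odd #|B|.
  apply: contrapT => /negP evenB; move: prodY.
  by rewrite signs Y4 (negbTE evenB) /=; clear=> h; lra.
rewrite /codes /cycles /code_coeff !inE /= YD BY Y4 /= walsh1 oddB eqxx a0.
by split=> //; split=> // q qY; exact: a4.
Qed.

Lemma facets_codes : two_level P ->
  finite_set (facets P) /\ (nb_facets P <= #|codes|)%N.
Proof.
move=> P2; pose rel F c := facets P F /\
  forall S, F (x S) <-> \sum_p code_coeff c p * walsh R p S = 0.
apply: (@fset_set_card_le _ _ (facets P) codes (fun c => xget classical_sets.set0 [set F | rel F c])).
move=> F facF; have [c cC Fc] := facet_code P2 facF; exists c => //.
apply: xget_unique => //= F' [facF' F'c].
have [fF _ _] := facF; have [fF' _ _] := facF'.
apply/seteqP; split.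
  by apply: (face_eq fF' fF) => S; rewrite Fc F'c.
by apply: (face_eq fF fF') => S; rewrite Fc F'c.
Qed.

(** Removing a fixed point of [A] is injective on the subsets of a given parity. *)
Lemma card_odd_subsets (T : finType) (A : {set T}) (b : bool) : A != set0 ->
  (#|[set B : {set T} | B \subset A & odd #|B| == b]%SET| <= 2 ^ #|A|.-1)%N.
Proof.
move=> /set0Pn[t tA].
have -> : #|A|.-1 = #|A :\ t| by rewrite (cardsD1 t A) tA.
rewrite -card_powerset -(@card_in_imset _ _ (fun B : {set T} => B :\ t)).
  apply: subset_leq_card; apply/subsetP => _ /imsetP[B + ->].
  by rewrite !inE => /andP[BA _]; exact: setSD.
move=> B B'; rewrite !inE => /andP[_ /eqP oB] /andP[_ /eqP oB'] BB'.
have tBB' : (t \in B) = (t \in B').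
  move: oB; rewrite -oB' (cardsD1 t B) (cardsD1 t B') BB' !oddD => /addIb.
  by do 2 case: (t \in _).
apply/setP => s; have [->//|st] := eqVneq s t.
by have /setP/(_ s) := BB'; rewrite !inE st.
Qed.

Lemma card_codes : (#|codes| <= 2 * #|D| + \sum_(Y in cycles) 2 ^ #|Y|.-1)%N.
Proof.
have -> : #|codes| = (\sum_(Y : {set {set V}})
    #|[set B : {set {set V}} | (Y, B) \in codes]%SET|)%N.
  transitivity (\sum_(Y : {set {set V}}) \sum_(B : {set {set V}})
      if (Y, B) \in codes then 1 else 0)%N.
    by rewrite pair_bigA -sum1_card big_mkcond; apply: eq_bigr => -[].
  apply: eq_bigr => Y _; rewrite -sum1_card [RHS]big_mkcond.
  by apply: eq_bigr => B _; rewrite inE.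
pose single := [set Y : {set {set V}} | Y \subset D & #|Y| == 1%N]%SET.
have -> : (2 * #|D| = \sum_(Y in single) 2)%N.
  by rewrite sum_nat_const cards_draws bin1 mulnC.
rewrite [X in (_ <= X + _)%N]big_mkcond [X in (_ <= _ + X)%N]big_mkcond -big_split /=.
apply: leq_sum => Y _.
have [YS|YS] := boolP (Y \in single).
  apply: leq_trans (leq_addr _ _); move: (YS); rewrite inE => /andP[YD /eqP Y1].
  apply: (@leq_trans #|powerset Y|); last by rewrite card_powerset Y1.
  apply: subset_leq_card.
  by apply/subsetP => B; rewrite !inE => /and3P[].
rewrite add0n; case: ifP => YZ.
  apply: leq_trans (@card_odd_subsets _ Y true _).
    apply: subset_leq_card; apply/subsetP => B; rewrite !inE /= => /and3P[YD -> ].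
    move: YS; rewrite inE YD /= => /negbTE ->.
    by rewrite /= => /andP[_ ->].
  by move: YZ; rewrite inE -card_gt0 => /and3P[_ /orP[] /eqP -> _].
rewrite leqn0 cards_eq0; apply/eqP/setP => B; rewrite !inE /=.
apply/negbTE; apply: contraFN YZ => /and3P[YD _].
by move: YS; rewrite !inE YD /= => /negbTE -> /= /andP[].
Qed.

(** * The inequality *)

Lemma cycles_sub Y : Y \in cycles -> Y \subset D.
Proof. by rewrite inE => /and3P[]. Qed.

Lemma cycle_walsh Y S : Y \in cycles -> walsh R Y (pattern S) = 1.
Proof. by rewrite inE => /and3P[_ _ /forallP/(_ S)/eqP]. Qed.

Lemma set0_notin_cycles : set0 \notin cycles.
Proof. by rewrite inE cards0 andbF. Qed.

(** Cut patterns and cycles are orthogonal families, and so are cut patterns and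
    the empty set. *)
Lemma cycle_packing : (#|patterns| * #|cycles|.+1 <= 2 ^ #|D|)%N.
Proof.
have -> : #|cycles|.+1 = #|set0 |: cycles| by rewrite cardsU1 set0_notin_cycles.
apply: (@walsh_packing R _ D) patterns_sub _ _.
  apply/subsetP => Y; rewrite in_setU1 powersetE => /orP[/eqP ->|/cycles_sub //].
  exact: sub0set.
move=> _ Y /imsetP[S _ ->]; rewrite in_setU1 => /orP[/eqP ->|YC].
  by rewrite walshC walsh0.
by rewrite walshC cycle_walsh.
Qed.

Lemma cycle_weight Y : Y \in cycles ->
  (2 ^ #|Y|.-1 <= 2 * #|D| ?= iff (#|Y| == 4%N) && (#|D| == 4%N))%N.
Proof.
move=> YC; have := subset_leq_card (cycles_sub YC).
move: YC; rewrite inE => /and3P[_ /orP[] /eqP -> _] YD; split=> //=.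
- by rewrite (leq_trans (_ : 4 <= 2 * 3)%N) // leq_mul2l.
- by rewrite ltn_eqF // (leq_trans (_ : 5 <= 2 * 3)%N) // leq_mul2l.
- by rewrite (leq_trans (_ : 8 <= 2 * 4)%N) // leq_mul2l.
- by rewrite -[(2 ^ 3)%N]/(2 * 4)%N eqn_mul2l /= eq_sym.
Qed.

Lemma patterns_gt0 : (0 < #|patterns|)%N.
Proof. by rewrite card_gt0; apply/set0Pn; exists (pattern set0); apply/imsetP; exists set0. Qed.

Lemma cycle_weights_sum :
  (\sum_(Y in cycles) 2 ^ #|Y|.-1 <= 2 * #|D| * #|cycles|)%N.
Proof.
rewrite mulnC -sum_nat_const; apply: leq_sum => Y YC; exact: cycle_weight.
Qed.

Lemma CUT_bound : two_level P ->
  (nb_vertices P * nb_facets P <= #|D| * 2 ^ #|D|.+1)%N.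
Proof.
move=> /facets_codes[_ N_le]; rewrite nb_vertices_CUT.
apply: leq_trans (leq_mul (leqnn _) (leq_trans N_le card_codes)) _.
apply: leq_trans (leq_mul (leqnn _) (leq_add (leqnn _) cycle_weights_sum)) _.
by rewrite -mulnS mulnCA expnS [leqRHS]mulnCA [leqRHS]mulnA leq_mul2l cycle_packing orbT.
Qed.

(** Both of the inequalities multiplied in [CUT_bound] must be tight, and
    the first one must be so cycle by cycle. *)
Lemma CUT_equality : two_level P -> (0 < #|D|)%N ->
  (nb_vertices P * nb_facets P)%N = (#|D| * 2 ^ #|D|.+1)%N ->
  (#|patterns| * #|cycles|.+1)%N = (2 ^ #|D|)%N /\
  forall Y, Y \in cycles -> #|Y| = 4%N /\ #|D| = 4%N.
Proof.
move=> /facets_codes[_ N_le] D_gt0; rewrite nb_vertices_CUT => KN.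
have K_gt0 := patterns_gt0.
have codes_le := leq_trans N_le card_codes.
have sum_le := cycle_weights_sum; have pack := cycle_packing.
set s := (\sum_(Y in cycles) _)%N in codes_le sum_le *.
have [packE sE] : (#|patterns| * #|cycles|.+1)%N = (2 ^ #|D|)%N /\
    s = (2 * #|D| * #|cycles|)%N.
  set K := #|patterns| in KN K_gt0 pack *; set C := #|cycles| in sum_le pack *.
  set d2 := (2 * #|D|)%N in codes_le sum_le *.
  have {}KN : (K * nb_facets P = d2 * 2 ^ #|D|)%N.
    by rewrite KN expnS mulnCA mulnA.
  have h1 : (K * nb_facets P <= K * (d2 + s))%N by rewrite leq_mul2l codes_le orbT.
  have h2 : (K * (d2 + s) <= K * (d2 * C.+1))%N.
    by rewrite leq_mul2l mulnS leq_add2l sum_le orbT.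
  have h3 : (d2 * (K * C.+1) <= d2 * 2 ^ #|D|)%N by rewrite leq_mul2l pack orbT.
  have d2_gt0 : (0 < d2)%N by rewrite muln_gt0.
  have swap : (K * (d2 * C.+1) = d2 * (K * C.+1))%N by rewrite mulnCA.
  split; apply/eqP.
    by rewrite -(eqn_pmul2l d2_gt0) eqn_leq h3 -KN -swap (leq_trans h1 h2).
  rewrite -(eqn_add2l d2) -mulnS -(eqn_pmul2l K_gt0) eqn_leq h2 swap.
  by rewrite (leq_trans h3) // -KN.
split=> // Y YC.
suff : (2 ^ #|Y|.-1 == 2 * #|D|)%N by rewrite (cycle_weight YC) => /andP[/eqP ? /eqP ?].
rewrite eqn_leq (cycle_weight YC) /= leqNgt; apply/negP => lt.
suff : (s < \sum_(Z in cycles) 2 * #|D|)%N by rewrite sum_nat_const mulnC -sE ltnn.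
rewrite /s (bigD1 Y) //= [ltnRHS](bigD1 Y) //= -addSn leq_add //.
by apply: leq_sum => Z /andP[ZC _]; exact: cycle_weight.
Qed.

(** * The two cases of equality *)

Definition edge_map m n (f : 'I_m -> E) (M : 'M[R]_(m, n)) (w : W) : 'rV[R]_n :=
  (\row_j (w (f j) : R)) *m M.

Fact edge_map_linear m n (f : 'I_m -> E) (M : 'M[R]_(m, n)) : linear (edge_map f M).
Proof.
move=> k v w; rewrite /edge_map scalemxAl -mulmxDl; congr (_ *m _).
by apply/rowP => j; rewrite !mxE !ffunE.
Qed.

HB.instance Definition _ m n f M :=
  GRing.isLinear.Build R W 'rV[R]_n _ (@edge_map m n f M) (edge_map_linear f M).

Lemma edge_map_inj m n (f : 'I_m -> E) (M : 'M[R]_(m, n)) (M' : 'M[R]_(n, m)) w1 w2 :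
  M *m M' = 1%:M -> (forall p, p \in D -> exists i, edge_pair (f i) = p) ->
  P w1 -> P w2 -> edge_map f M w1 = edge_map f M w2 -> w1 = w2.
Proof.
move=> MM' fD P1 P2 /(congr1 (mulmx^~ M')); rewrite /edge_map -!mulmxA MM' !mulmx1.
move=> /rowP e; apply: CUT_eq => // p /fD[i ip]; exists (f i) => //.
by have := e i; rewrite !mxE.
Qed.

(** The coordinates [1 - 2 * w e], one edge for each pair, map the points of the
    cuts onto all sign vectors. *)
Lemma CUT_cube : #|patterns| = (2 ^ #|D|)%N -> affinely_isomorphic P (@cube R #|D|).
Proof.
move=> K.
have patternsE : patterns = powerset D.
  by apply/eqP; rewrite eqEcard patterns_sub card_powerset K leqnn.
have /choice[f fE] : forall i : 'I_#|D|, exists e, edge_pair e = enum_val i.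
  by move=> i; apply/edge_of_pair/enum_valP.
have valE S : edge_map f (-2)%:M (x S) + const_mx 1 =
    sign_row R [set i | enum_val i \in pattern S]%SET.
  apply/rowP => i; rewrite /edge_map mul_mx_scalar !mxE !ffunE mem_cut fE [i \in _]inE.
  by case: (_ \in pattern S) => /=; clear; lra.
apply: (@isomorphic_conv_hull _ _ _ _ x _ (edge_map f (-2)%:M) (const_mx 1)).
- move=> w1 w2 P1 P2.
  apply: (@edge_map_inj _ _ f _ ((-2)^-1)%:M) => // [|p pD].
    by rewrite -scalar_mxM mulfV // lt_eqF // oppr_lt0 ltr0n.
  by exists (enum_rank_in pD p); rewrite fE enum_rankK_in.
- exact: cube_conv_hull.
- move=> S; have -> := valE S; move=> i; rewrite mxE.
  by case: (_ \in _); rewrite ?expr0 ?expr1; clear; lra.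
move=> y /cube_sub_hull; apply: conv_hull_mono => _ [J _ <-].
have /imsetP[S _ SJ] : [set enum_val i | i in J]%SET \in patterns.
  rewrite patternsE inE; apply/subsetP => _ /imsetP[i _ ->]; exact: enum_valP.
exists S => //; have -> := valE S; congr sign_row; apply/setP => i.
by rewrite inE -SJ mem_imset //; exact: enum_val_inj.
Qed.

(** The rows are [++++], [++--], [+-+-] and [+--+], with their negatives the sign
    vectors of length 4 that have an even number of minus signs. *)
Definition hadamard_sign (i j : 'I_4) : bool := [&& i != ord0, j != ord0 & i != j].

Definition hadamard : 'M[R]_4 := \matrix_(i, j) (-1) ^+ hadamard_sign i j.

Lemma hadamard_sqr : (-2^-1 *: hadamard) *m (-2^-1 *: hadamard) = 1%:M.
Proof.
rewrite -scalemxAl -scalemxAr scalerA; apply/matrixP => i j; rewrite !mxE.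
rewrite !big_ord_recl big_ord0 !mxE /hadamard_sign.
case: i => [[|[|[|[|//]]]] ?]; case: j => [[|[|[|[|//]]]] ?] /=; lra.
Qed.

Lemma hadamard_row (s : 'I_4 -> bool) : ~~ odd (\sum_j s j) ->
  exists i b, forall j, s j = b (+) hadamard_sign i j.
Proof.
rewrite !big_ord_recl big_ord0 => ev.
pose o0 : 'I_4 := ord0; pose o1 : 'I_4 := lift ord0 ord0.
pose o2 : 'I_4 := lift ord0 (lift ord0 ord0).
pose o3 : 'I_4 := lift ord0 (lift ord0 (lift ord0 ord0)).
exists (if s o1 == s o0 then if s o2 == s o0 then o0 else o1
        else if s o2 == s o0 then o2 else o3), (s o0).
have ordE (j : 'I_4) : [\/ j = o0, j = o1, j = o2 | j = o3].
  case: j => [[|[|[|[|//]]]] ?]; [constructor 1|constructor 2|constructor 3|constructor 4];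
  exact: val_inj.
move: ev; rewrite -/o0 -/o1 -/o2 -/o3.
move=> ev j; case: (ordE j) => ->; move: ev;
  by case: (s o0); case: (s o1); case: (s o2); case: (s o3).
Qed.

Lemma hadamard_even i b : ~~ odd (\sum_j (b (+) hadamard_sign i j)).
Proof.
by rewrite !big_ord_recl big_ord0; case: b; case: i => [[|[|[|[|//]]]] ?].
Qed.

(** The sign vector of a cut is plus or minus a row of the Hadamard matrix, and
    multiplying by this matrix turns the row into a signed axis, since the rows
    are orthogonal. *)
Lemma CUT_cross4 (f : 'I_4 -> E) (q : 'I_4 -> {set V}) :
  injective q -> D = [set q j | j in 'I_4]%SET ->
  patterns = [set A : {set {set V}} | A \subset D & ~~ odd #|A|]%SET ->
  (forall j, edge_pair (f j) = q j) ->
  affinely_isomorphic P (@cross_polytope R 4).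
Proof.
move=> q_inj DE patE fE.
have qD j : q j \in D by rewrite DE; apply/imsetP; exists j.
pose M : 'M[R]_4 := -2^-1 *: hadamard.
(* [M] is the Hadamard matrix scaled to be an involution; [b0] moves the image
   of the center [w = 1/2] of the cut polytope to the origin. *)
pose b0 : 'rV[R]_4 := -2^-1 *: (const_mx 1 *m M).
have MM : M *m M = 1%:M by exact: hadamard_sqr.
have valE S i b : (forall j, (q j \in pattern S) = b (+) hadamard_sign i j) ->
    edge_map f M (x S) + b0 = signed_axis R (i, b).
  move=> Sq; rewrite /edge_map.
  have -> : (\row_j (x S (f j) : R)) = 2^-1 *: const_mx 1 + (-1) ^+ b *: row i M.
    apply/rowP => j; rewrite !mxE !ffunE mem_cut fE Sq.
    by case: b {Sq}; case: (hadamard_sign i j) => /=; clear; lra.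
  rewrite mulmxDl /b0 -!scalemxAl -row_mul MM addrAC scaleNr addrN add0r.
  by rewrite rowE mulmx1.
have sum_card (A : {set {set V}}) : A \subset D -> #|A| = (\sum_j (q j \in A))%N.
  move=> AD; transitivity (\sum_(p in D) (p \in A))%N.
    rewrite -sum1_card big_mkcond [RHS]big_mkcond; apply: eq_bigr => p _.
    by case: (boolP (p \in A)) => [/(subsetP AD) ->|_] //; case: ifP.
  rewrite DE big_imset /=; last by move=> ? ? _ _; exact: q_inj.
  by apply: eq_bigl.
apply: (@isomorphic_conv_hull _ _ _ _ x _ (edge_map f M) b0).
- move=> w1 w2; apply: (edge_map_inj MM) => p.
  by rewrite DE => /imsetP[j _ ->]; exists j.
- exact: cross_conv_hull.
- move=> S; have : pattern S \in patterns by apply/imsetP; exists S.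
  rewrite patE inE pattern_sub sum_card ?pattern_sub // => /hadamard_row[i [b Sq]].
  rewrite (valE S i b Sq); exact: (faceS (cross_vertex R (i, b)) (erefl _)).
move=> y /(@cross_sub_hull R 4 isT); apply: conv_hull_mono.
move=> _ [[i b] _ <-]; pose A := [set q j | j in [set j | b (+) hadamard_sign i j]]%SET.
have qA j : (q j \in A) = b (+) hadamard_sign i j by rewrite mem_imset // inE.
have AD : A \subset D by apply/subsetP => _ /imsetP[j _ ->]; exact: qD.
have /imsetP[S _ SA] : A \in patterns.
  rewrite patE inE AD sum_card //= (eq_bigr (fun j => (b (+) hadamard_sign i j) : nat)).
    exact: hadamard_even.
  by move=> j _; rewrite qA.
by exists S => //; apply: valE => j; rewrite -SA.
Qed.

(** The only cycle is [D] itself, so there are [2 ^ 4 / 2 = 8] patterns; they are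
    even subsets of [D], of which there are 8. *)
Lemma CUT_cross : (forall Y, Y \in cycles -> #|Y| = 4%N /\ #|D| = 4%N) ->
  cycles != set0 -> (#|patterns| * #|cycles|.+1)%N = (2 ^ #|D|)%N ->
  affinely_isomorphic P (@cross_polytope R #|D|).
Proof.
move=> C4 /set0Pn[Y YC] K.
have D4 : #|D| = 4%N by have [] := C4 _ YC.
have cycleE Z : Z \in cycles -> Z = D.
  by move=> ZC; apply/eqP; rewrite eqEcard cycles_sub // D4; have [->] := C4 _ ZC.
have YD := cycleE _ YC.
have cycles1 : cycles = [set D]%SET.
  apply/setP => Z; rewrite in_set1; apply/idP/eqP => [/cycleE //|->].
  by rewrite -YD.
have K8 : #|patterns| = 8%N.
  by move: K; rewrite cycles1 cards1 D4 -[(2 ^ 4)%N]/(8 * 2)%N => /eqP; rewrite eqn_mul2r /= => /eqP.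
have patE : patterns = [set A : {set {set V}} | A \subset D & ~~ odd #|A|]%SET.
  apply/eqP; rewrite eqEcard K8; apply/andP; split.
    apply/subsetP => _ /imsetP[S _ ->]; rewrite inE pattern_sub /=.
    have := cycle_walsh S YC; rewrite YD walsh_card (setIidPr (pattern_sub S)).
    rewrite -signr_odd; by case: (odd _) => //=; rewrite expr1; clear=> h; exfalso; move: h; lra.
  have D0 : D != set0 by rewrite -card_gt0 D4.
  apply: leq_trans (leq_trans (card_odd_subsets false D0) _); last by rewrite D4.
  by apply: subset_leq_card; apply/subsetP => A; rewrite !inE eqbF_neg.
pose q (j : 'I_4) : {set V} := enum_val (cast_ord (esym D4) j).
have q_inj : injective q by move=> i j /enum_val_inj/cast_ord_inj.
have DE : D = [set q j | j in 'I_4]%SET.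
  apply/esym/eqP; rewrite eqEcard (card_imset _ q_inj) card_ord D4 leqnn andbT.
  by apply/subsetP => _ /imsetP[j _ ->]; exact: enum_valP.
have /choice[f fE] : forall j, exists e, edge_pair e = q j.
  by move=> j; apply/edge_of_pair/enum_valP.
rewrite D4; exact: CUT_cross4 q_inj DE patE fE.
Qed.

(** * Lower bounds for polytopes isomorphic to the cube or cross-polytope *)

Lemma card_ord_sets n : #|{set 'I_n}| = (2 ^ n)%N.
Proof. by rewrite -[LHS]cardsT -powersetT card_powerset cardsT card_ord. Qed.

Lemma cube_CUT_bound : two_level P -> affinely_isomorphic P (@cube R #|D|) ->
  (#|D| * 2 ^ #|D|.+1 <= nb_vertices P * nb_facets P)%N.
Proof.
move=> P2 [g [b0 hP]]; have [fin _] := facets_codes P2.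
have := nb_facets_pullback hP fin (@cube_side_inj R _) (@cube_facet R _).
have := nb_vertices_pullback hP finite_vertices_CUT (@sign_row_inj R _) (@cube_vertex R _).
rewrite card_ord_sets card_prod card_ord card_bool.
by move=> hv hf; rewrite expnS mulnCA mulnA mulnC leq_mul // mulnC.
Qed.

Lemma cross_CUT_bound : two_level P -> (0 < #|D|)%N ->
  affinely_isomorphic P (@cross_polytope R #|D|) ->
  (#|D| * 2 ^ #|D|.+1 <= nb_vertices P * nb_facets P)%N.
Proof.
move=> P2 D_gt0 [g [b0 hP]]; have [fin _] := facets_codes P2.
have := nb_facets_pullback hP fin (cross_side_inj D_gt0) (fun J => cross_facet R J D_gt0).
have := nb_vertices_pullback hP finite_vertices_CUT (@signed_axis_inj R _) (@cross_vertex R _).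
rewrite card_ord_sets card_prod card_ord card_bool.
by move=> hv hf; rewrite expnS mulnA leq_mul.
Qed.

End CutPolytope.

Theorem corollary36 (R : realType) (G : graph) (d : nat) :
  two_level (@CUT R G) ->
  d = aff_dim (@CUT R G) ->
  (nb_vertices (@CUT R G) * nb_facets (@CUT R G) <= d * 2 ^ d.+1)%N /\
  ((nb_vertices (@CUT R G) * nb_facets (@CUT R G))%N = (d * 2 ^ d.+1)%N <->
   affinely_isomorphic (@CUT R G) (@cube R d) \/
   affinely_isomorphic (@CUT R G) (@cross_polytope R d)).
Proof.
move=> P2 ->; rewrite aff_dim_CUT; have bound := CUT_bound P2.
split=> //; split=> [KN|iso].
  have [D0|D_gt0] := posnP #|edge_pairs G|.
    left; apply: CUT_cube; apply/eqP.
    have := cycle_packing R G; rewrite D0 expn0 => pack.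
    rewrite eqn_leq patterns_gt0 andbT; apply: leq_trans pack.
    by rewrite leq_pmulr.
  have [K C4] := CUT_equality P2 D_gt0 KN.
  have [C0|C0] := eqVneq (cycles R G) set0.
    by left; apply: CUT_cube; rewrite -K C0 cards0 muln1.
  by right; exact: CUT_cross.
apply/eqP; rewrite eqn_leq bound /=.
have [->//|D_gt0] := posnP #|edge_pairs G|.
by case: iso => [/cube_CUT_bound|/cross_CUT_bound]; apply.
Qed.
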